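(* Let $p\ge1$, let $X:[0,1]\to G(V)$ be a geometric $p$-rough path, and let $U_1,U_2$ be Banach spaces. For $i=1,2$, let $\beta_i\in(X,E^{U_i}_X)$ be a slowly-varying one-form such that $\|\beta_i\|_{\theta_i}^{\omega_i}<\infty$ for a control $\omega_i$ and $\theta_i>1$. Define $\beta\in(X,E^{U_1\otimes U_2}_X)$ by $$\beta(X_t):=\Big(\int_{r=0}^t\beta_1(X_r)\,dX_r\Big)\otimes\beta_2(X_t)+\textstyle\prod_{\le[p]}\big(\beta_1(X_t)\succ\beta_2(X_t)\big),\qquad t\in[0,1].$$ Then with $\omega:=\omega_1+\omega_2+\|X\|^p_{p-var}$ (that is, $\omega(s,t)=\omega_1(s,t)+\omega_2(s,t)+\|X\|^p_{p-var,[s,t]}$) and $\theta:=\min(\theta_1,\theta_2)$, $$\|\beta\|_\theta^\omega\le C_{p,\theta,\omega(0,1)}\,\|\beta_1\|_{\theta_1}^{\omega_1}\,\|\beta_2\|_{\theta_2}^{\omega_2},$$ where $C_{p,\theta,\omega(0,1)}$ is a constant depending on $p,\theta,\omega(0,1)$.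
   Context: $V$ is a Banach space whose tensor powers are equipped with admissible norms (permutations of factors are isometries and $\|v\otimes w\|\le\|v\|\|w\|$). Elements of the (completed) tensor algebra over $V$ are written $x=\sum_{k\ge0}x^k$ with $x^k=\pi_k(x)\in V^{\otimes k}$. For $\sigma\in S_N$, $\sigma\cdot(v_1\otimes\cdots\otimes v_N):=v_{\sigma1}\otimes\cdots\otimes v_{\sigma N}$, extended linearly. $\mathrm{Sh}(n,m)\subset S_{n+m}$ is the set of $\tau$ whose word $\tau(1)\cdots\tau(n+m)$ is a shuffle of $1\cdots n$ and $(n+1)\cdots(n+m)$. With $1_k$ the identity of $S_k$, for $n,m\ge1$ one writes $1_n\succ1_m$ for the sum of those $\tau\in\mathrm{Sh}(n,m)$ with $\tau(n+m)=n+m$ (shuffle $1\cdots n$ with $(n+1)\cdots(n+m-1)$, then append the letter $n+m$). $G(V)$ is the group of group-like elements (algebraic exponentials of Lie series), i.e. the characters of the shuffle algebra: $x^0=1$ and $x^n\otimes x^m=\sum_{\tau\in\mathrm{Sh}(n,m)}\tau^{-1}\cdot x^{n+m}$ for all $n,m$. On $G(V)$, $d(a,b):=\max_{k\in\mathbb N,\,k\ge1}\|\pi_k(a^{-1}b)\|^{1/k}$. A control is a continuous super-additive function $\omega:\{(s,t):0\le s\le t\le1\}\to[0,\infty)$ vanishing on the diagonal. $X:[0,1]\to G(V)$ is a geometric $p$-rough path if there is a control $\omega$ with $\|X\|^p_{p-var,[s,t]}:=\sup_D\sum_k d(X_{t_k},X_{t_{k+1}})^p\le\omega(s,t)$ for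 every $s\le t$, the supremum being over finite partitions $D=\{t_k\}$ of $[s,t]$. $X_{s,t}:=X_s^{-1}X_t$. $[p]:=\max\{n\in\mathbb N:n\le p\}$. For a Banach space $U$ and $a\in G(V)$, $E^U_a$ is the vector space of functions $\phi:G(V)\to U$ of the form $\phi(x)=\sum_{k=1}^{[p]}\phi^k(x^k)$ with $\phi^k\in L(V^{\otimes k},U)$ (continuous linear maps). $\|\phi\|_k:=\|\phi^k\|$ (operator norm), $\|\phi\|:=\max_{k=1,\dots,[p]}\|\phi\|_k$. For $b\in G(V)$, $(\phi)_b\in E^U_{ab}$ is $(\phi)_b(x):=\phi(bx)-\phi(b)$. $\beta\in(X,E^U_X)$ means that $\beta$ assigns to each $X_t$, $t\in[0,1]$, an element $\beta(X_t)\in E^U_{X_t}$. For a control $\omega$ and $\theta>1$, $$\|\beta\|_\theta^\omega:=\sup_{t\in[0,1]}\|\beta(X_t)\|+\max_{k=1,\dots,[p]}\sup_{0\le s<t\le1}\frac{\|\beta(X_t)-(\beta(X_s))_{X_{s,t}}\|_k}{\omega(s,t)^{\theta-k/p}}.$$ $\beta$ is a slowly-varying one-form if $\|\beta\|_\theta^\omega<\infty$ for some control $\omega$ and some $\theta>1$; then $\int_{r=0}^t\beta(X_r)\,dX_r:=\lim_{|D|\to0}\sum_k\beta(X_{t_k})(X_{t_k,t_{k+1}})$ over finite partitions $D=\{t_k\}$ of $[0,t]$, which exists. Truncated iterated integration: for $\phi_i=\sum_{k=1}^{[p]}\phi_i^k\in E^{U_i}_{X_t}$, $i=1,2$, $\prod_{\le[p]}(\phi_1\succ\phi_2)\in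 E^{U_1\otimes U_2}_{X_t}$ is $$x\mapsto\sum_{\substack{k_1+k_2\le[p]\\ k_i=1,\dots,[p]}}(\phi_1^{k_1}\otimes\phi_2^{k_2})\Big((1_{k_1}\succ1_{k_2})\cdot x^{k_1+k_2}\Big),\qquad x\in G(V).$$ For $u\in U_1$, $u\otimes\phi_2$ denotes $x\mapsto u\otimes\phi_2(x)$.
   Formalization: θ is min(θ1,θ2,([p]+1)/p), as the estimate fails for larger θ; the norms are assumed to satisfy ‖φ1⊗φ2‖≤‖φ1‖‖φ2‖ for continuous linear maps, needed for a uniform constant; and 1_n≻1_m acts on tensors by τ^{-1} (as in the group-like identity) rather than τ. *)

(* Defs.v *)
From HB Require Import structures.
From mathcomp Require Import all_boot all_order all_algebra all_fingroup.
From mathcomp Require Import all_classical all_reals all_analysis.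
From mathcomp Require Import zify.
Set Implicit Arguments.
Unset Strict Implicit.
Unset Printing Implicit Defensive.
Import Order.TTheory GRing.Theory Num.Theory.
Import numFieldNormedType.Exports.
Local Open Scope classical_set_scope.
Local Open Scope ring_scope.

Definition tset (A : Type) (k : nat) (v : k.-tuple A) (i : 'I_k) (a : A) :
  k.-tuple A := [tuple if j == i then a else tnth v j | j < k].

Definition multilinear (R : realType) (V E : lmodType R) (k : nat)
    (f : k.-tuple V -> E) :=
  forall (v : k.-tuple V) (i : 'I_k), linear (fun a : V => f (tset v i a)).

Definition bilin (R : realType) (A B E : lmodType R) (f : A -> B -> E) :=
  (forall a, linear (f a)) /\ (forall b, linear (fun a => f a b)).

(** [T k] is a completion of the algebraic tensor power of [V] for an
    admissible norm: [tpure v] is [v_1 (x) ... (x) v_k], the span of the pure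
    tensors is the algebraic tensor power (multilinear maps extend to it,
    [tpure_univ]) and it is dense.  The permutation action and the product are
    determined by their values on pure tensors.  Degree 0 is the scalar field
    and degree 1 is [V]. *)
Record tensor_powers (R : realType) (V : completeNormedModType R) := {
  tpow :> nat -> completeNormedModType R;
  tpure : forall k, k.-tuple V -> tpow k;
  tmul : forall m n, tpow m -> tpow n -> tpow (m + n);
  tact : forall k, 'S_k -> tpow k -> tpow k;
  tpure_multilinear : forall k, multilinear (@tpure k);
  tpure_univ : forall k (E : lmodType R) (f : k.-tuple V -> E),
    multilinear f -> forall s : seq (R * k.-tuple V),
    \sum_(q <- s) q.1 *: tpure q.2 = 0 -> \sum_(q <- s) q.1 *: f q.2 = 0;
  tpure_dense : forall k,
    dense [set \sum_(q <- s) q.1 *: tpure q.2 | s in [set: seq (R * k.-tuple V)]];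
  norm_tpure0 : `|tpure [tuple]| = 1;
  norm_tpure1 : forall v : V, `|tpure [tuple v]| = `|v|;
  tmul_bilin : forall m n, bilin (@tmul m n);
  tmul_tpure : forall m n (v : m.-tuple V) (w : n.-tuple V),
    tmul (tpure v) (tpure w) = tpure [tuple of v ++ w];
  norm_tmul : forall m n (x : tpow m) (y : tpow n),
    `|tmul x y| <= `|x| * `|y|;
  tact_linear : forall k (s : 'S_k), linear (tact s);
  tact_tpure : forall k (s : 'S_k) (v : k.-tuple V),
    tact s (tpure v) = tpure [tuple tnth v (s i) | i < k];
  norm_tact : forall k (s : 'S_k) (x : tpow k), `|tact s x| = `|x| }.

(** Likewise, a completion of the algebraic tensor product of two spaces. *)
Record tensor_product (R : realType) (U1 U2 : completeNormedModType R) := {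
  tprod :> completeNormedModType R;
  tens : U1 -> U2 -> tprod;
  tens_bilin : bilin tens;
  tens_univ : forall (E : lmodType R) (f : U1 -> U2 -> E),
    bilin f -> forall s : seq (U1 * U2),
    \sum_(q <- s) tens q.1 q.2 = 0 -> \sum_(q <- s) f q.1 q.2 = 0;
  tens_dense :
    dense [set \sum_(q <- s) tens q.1 q.2 | s in [set: seq (U1 * U2)]];
  norm_tens : forall u v, `|tens u v| <= `|u| * `|v| }.

(** The operator norm; [+oo] on unbounded maps. *)
Definition opnorm (R : realType) (E F : normedModType R) (f : E -> F) : \bar R :=
  ereal_sup [set `|f x|%:E | x in [set x : E | `|x| <= 1]].

Definition clinear (R : realType) (E F : normedModType R) (f : E -> F) :=
  linear f /\ continuous f.

Section TensorAlgebra.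
Context {R : realType} {V : completeNormedModType R} {T : tensor_powers V}.

Definition tseries := forall k, T k.

Definition tcastp (m n : nat) (e : m = n) (x : T m) : T n := ecast k (T k) e x.

Definition tsone : tseries :=
  fun k => if k is 0 then tpure T [tuple] else 0.

Definition tsmul (a b : tseries) : tseries := fun n =>
  \sum_(i < n.+1) tcastp (subnKC (leq_ord i)) (tmul (a i) (b (n - i)%N)).

Definition tsinv (a : tseries) : tseries :=
  get [set b : tseries | tsmul a b = tsone /\ tsmul b a = tsone].

(** The word [tau(1) ... tau(n)], with letters numbered from 0. *)
Definition pword (n : nat) (tau : 'S_n) : seq nat :=
  [seq val (tau i) | i <- enum 'I_n].

Definition Sh (n m : nat) : {set 'S_(n + m)} :=
  [set tau : 'S_(n + m) |
    subseq (iota 0 n) (pword tau) && subseq (iota n m) (pword tau)].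

Definition Shlast (n m : nat) : {set 'S_(n + m)} :=
  [set tau in Sh n m | last 0%N (pword tau) == (n + m).-1].

(** Characters of the shuffle algebra. *)
Definition grouplike (x : tseries) :=
  x 0%N = tpure T [tuple] /\
  forall n m, tmul (x n) (x m) =
    \sum_(tau in Sh n m) tact tau^-1%g (x (n + m)%N).

(** The action of [1_n > 1_m] on tensors.  A shuffle [tau] acts by [tau^-1], as
    in [grouplike]: this is the convention for which [x^n (x) x^m] is the sum of
    the two half-shuffles of [x^{n+m}], and [(f (x) g)((1_n > 1_m) . x)] the
    iterated integral of [f] against [dg].  Acting by [tau] gives the same
    element when [n + m <= 3], but not for [n = 1], [m = 3]. *)
Definition half_shuffle (n m : nat) (x : T (n + m)) : T (n + m) :=
  \sum_(tau in Shlast n m) tact tau^-1%g x.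

(** [d(a,b)] and the p-variation take values in the extended reals. *)
Definition gdist (a b : tseries) : \bar R :=
  ereal_sup [set (`|tsmul (tsinv a) b k| `^ k%:R^-1)%:E |
    k in [set k : nat | (0 < k)%N]].

End TensorAlgebra.
Arguments tseries {R V} T.

Section OneForms.
Context {R : realType} {V : completeNormedModType R} {T : tensor_powers V}.

(** An element [x |-> \sum_(1 <= k <= N) phi^k(x^k)] of [E^U_a] is encoded by the
    family of its coefficients [phi^k], which the function determines since the
    [x^k], [x] group-like, span a dense subspace of [T k].  Only the
    coefficients of index [1 <= k <= N] are relevant, with [N] the integer part
    of [p]. *)
Definition eform (U : completeNormedModType R) := forall k, T k -> U.

Definition is_eform (U : completeNormedModType R) (N : nat) (phi : eform U) :=
  forall k, (1 <= k <= N)%N -> clinear (phi k).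

Definition form_eval (U : completeNormedModType R) (N : nat) (phi : eform U)
    (x : tseries T) : U :=
  \sum_(1 <= k < N.+1) phi k (x k).

(** The coefficients of [x |-> phi(bx) - phi(b)], see [form_eval_translate]. *)
Definition translate (U : completeNormedModType R) (N : nat) (phi : eform U)
    (b : tseries T) : eform U :=
  fun k y => \sum_(i < (N - k).+1) phi (i + k)%N (tmul (b i) y).

Definition form_norm (U : completeNormedModType R) (N : nat) (phi : eform U) :
    \bar R :=
  \big[maxe/0%E]_(1 <= k < N.+1) opnorm (phi k).

Section Product.
Context {U1 U2 : completeNormedModType R} (W : tensor_product U1 U2).

Definition is_tensor_map (m n : nat) (f : T m -> U1) (g : T n -> U2)
    (h : T (m + n) -> W) :=
  clinear h /\ forall x y, h (tmul x y) = tens W (f x) (g y).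

(** The continuous linear map [f (x) g]. *)
Definition tensor_map (m n : nat) (f : T m -> U1) (g : T n -> U2) :
    T (m + n) -> W :=
  get [set h | is_tensor_map f g h].

(** Compatibility of the norms of [V^{(x)k}] and [U1 (x) U2]: tensor products of
    continuous linear maps are continuous, with [|f (x) g| <= |f| |g|]. *)
Definition tensor_maps_bounded :=
  forall (m n : nat) (f : T m -> U1) (g : T n -> U2),
    clinear f -> clinear g ->
    exists2 h, is_tensor_map f g h & (opnorm h <= opnorm f * opnorm g)%E.

(** The coefficients of the truncated iterated integral, see
    [form_eval_trunc_prod]. *)
Definition trunc_prod (phi1 : eform U1) (phi2 : eform U2) : eform W :=
  fun k y => \sum_(j < k | (0 < j)%N)
    tensor_map (phi1 j) (phi2 (k - j)%N)
      (half_shuffle (tcastp (esym (subnKC (ltnW (ltn_ord j)))) y)).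

Definition tens_form (u : U1) (phi : eform U2) : eform W :=
  fun k y => tens W u (phi k y).

End Product.

End OneForms.
Arguments eform {R V} T U.
Arguments translate {R V T U} N phi b k y.
Arguments trunc_prod {R V T U1 U2} W phi1 phi2 k y.
Arguments tens_form {R V T U1 U2} W u phi k y.
Arguments tensor_maps_bounded {R V} T {U1 U2} W.

Section Coefficients.
Context {R : realType} {V : completeNormedModType R} {T : tensor_powers V}.

Lemma tcastp_linear (m n : nat) (e : m = n) : linear (tcastp e : T m -> T n).
Proof. by case: _ / e. Qed.

Lemma norm_tcastp (m n : nat) (e : m = n) (x : T m) : `|tcastp e x| = `|x|.
Proof. by case: _ / e. Qed.

Lemma tcastp_tpure (m n : nat) (e : m = n) (v : m.-tuple V) :
  tcastp e (tpure T v) = tpure T (tcast e v).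
Proof. by case: _ / e. Qed.

Lemma tcastp_tseries (m n : nat) (e : m = n) (x : tseries T) :
  tcastp e (x m) = x n.
Proof. by case: _ / e. Qed.

Lemma eform_tcastp (U : completeNormedModType R) (phi : eform T U)
    (m n : nat) (e : m = n) (x : T m) :
  phi n (tcastp e x) = phi m x.
Proof. by case: _ / e. Qed.

Lemma tmulx1 (n : nat) (x : T n) :
  tcastp (addn0 n) (tmul x (tpure T [tuple])) = x.
Proof.
pose f y := tcastp (addn0 n) (tmul y (tpure T [tuple])) - y.
have flin : linear f.
  move=> a y z; rewrite /f (tmul_bilin T n 0).2 tcastp_linear scalerBr.
  by rewrite opprD addrACA.
have fle y : `|f y| <= 2 * `|y|.
  rewrite (le_trans (ler_normB _ _))// norm_tcastp mulr_natl mulr2n lerD2r.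
  by rewrite (le_trans (norm_tmul _ _))// norm_tpure0 mulr1.
have f0 : f 0 = 0 by have := flin (-1) 0 0; rewrite scaleN1r oppr0 addr0 scaleN1r addNr.
have fpure s : f (\sum_(q <- s) q.1 *: @tpure R V T n q.2) = 0.
  elim: s => [|q s IH]; first by rewrite big_nil f0.
  rewrite big_cons flin IH addr0 /f tmul_tpure tcastp_tpure.
  suff -> : tcast (addn0 n) [tuple of q.2 ++ [tuple]] = q.2.
    by rewrite subrr scaler0.
  by apply: val_inj; apply: (etrans (val_tcast (addn0 n) _)); rewrite /= cats0.
apply/eqP; rewrite -subr_eq0 -/(f x) -normr_le0 leNgt; apply/negP => fx0.
have r0 : 0 < `|f x| / 2 by rewrite divr_gt0.
have xB : ball x (`|f x| / 2) !=set0 by exists x; exact: ballxx.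
have [y [xy [s _ ys]]] := tpure_dense xB (ball_open x _).
move: xy; rewrite -ball_normE /ball_ /= -ys => xy.
have : `|f x| < `|f x|; last by rewrite ltxx.
have {1}-> : f x = f (- \sum_(q <- s) q.1 *: @tpure R V T n q.2 + x).
  by rewrite -scaleN1r flin fpure scaler0 add0r.
by rewrite (le_lt_trans (fle _))// addrC mulrC -ltr_pdivlMr.
Qed.

Lemma sum_triangle (G : nmodType) (F : nat -> nat -> G) (N : nat) :
  \sum_(1 <= k < N.+1) \sum_(0 <= i < (N - k).+1) F i k =
  \sum_(1 <= n < N.+1) \sum_(0 <= i < n) F i (n - i)%N.
Proof.
elim: N => [|N IH]; first by rewrite !big_geq.
rewrite [RHS]big_nat_recr //= -IH.
rewrite (eq_big_nat _ _ (F2 := fun k => \sum_(0 <= i < (N.+1 - k)) F i k +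
   F (N.+1 - k)%N k)); last by move=> k kN; rewrite big_nat_recr.
rewrite big_split /=; congr (_ + _).
  rewrite big_nat_recr //= subnn.
  rewrite [X in _ + X]big_geq// addr0.
  by apply: eq_big_nat => k /andP[_ kN]; rewrite subSn.
rewrite big_add1 [RHS]big_nat_rev /=; apply: eq_big_nat => i /andP[_ iN].
by rewrite add0n subKn.
Qed.

Lemma form_eval_translate (U : completeNormedModType R) (N : nat)
    (phi : eform T U) (b x : tseries T) :
  is_eform N phi -> x 0%N = tpure T [tuple] ->
  form_eval N (translate N phi b) x =
  form_eval N phi (tsmul b x) - form_eval N phi b.
Proof.
move=> Hphi x0; rewrite /form_eval /translate.
under eq_bigr do rewrite -(big_mkord xpredT
  (fun i => phi (i + _)%N (tmul (b i) (x _)))).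
rewrite (sum_triangle (fun i k => phi (i + k)%N (tmul (b i) (x k)))).
rewrite -sumrB; apply: eq_big_nat => n nN.
have [lphi _] := Hphi _ nN.
have phiD u v : phi n (u + v) = phi n u + phi n v.
  by rewrite -[u]scale1r lphi !scale1r.
have phi0 : phi n 0 = 0.
  by apply: (@addrI _ (phi n 0)); rewrite -phiD !addr0.
rewrite /tsmul (big_morph _ phiD phi0) big_ord_recr /=.
have -> : phi n (tcastp (subnKC (leq_ord ord_max)) (tmul (b n) (x (n - n)%N)))
   = phi n (b n).
  have E : (n - n = 0)%N by rewrite subnn.
  rewrite -[in RHS](tmulx1 (b n)) !eform_tcastp -x0.
  by rewrite E.
rewrite addrK big_mkord; apply: eq_bigr => i _.
by rewrite eform_tcastp.
Qed.

Lemma form_eval_trunc_prod (U1 U2 : completeNormedModType R)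
    (W : tensor_product U1 U2) (N : nat) (phi1 : eform T U1) (phi2 : eform T U2)
    (x : tseries T) :
  form_eval N (trunc_prod W phi1 phi2) x =
  \sum_(1 <= k1 < N.+1) \sum_(1 <= k2 < N.+1 | (k1 + k2 <= N)%N)
    tensor_map W (phi1 k1) (phi2 k2) (half_shuffle (x (k1 + k2)%N)).
Proof.
pose H i k : W := tensor_map W (phi1 i) (phi2 k) (half_shuffle (x (i + k)%N)).
pose F i k : W := if (0 < i)%N then H i k else 0.
transitivity (\sum_(1 <= n < N.+1) \sum_(0 <= i < n) F i (n - i)%N).
  rewrite /form_eval /trunc_prod; apply: eq_big_nat => n nN.
  rewrite big_mkord big_mkcond /=; apply: eq_bigr => i _.
  by rewrite /F; case: ifP => // _; rewrite tcastp_tseries.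
rewrite -sum_triangle [RHS](exchange_big_dep xpredT)//=.
apply: eq_big_nat => k /andP[k0 kN].
rewrite (big_ltn (ltn0Sn _)) {1}/F ltnn add0r.
rewrite [RHS]big_nat_cond [LHS]big_nat_cond.
rewrite (@big_nat_widen _ _ _ _ _ N.+1); last by rewrite ltnS leq_subr.
rewrite [LHS]big_nat_cond [RHS]big_nat_cond; apply: eq_big => i; last first.
  by move=> /andP[/andP[i0 _] _]; rewrite /F i0.
by apply/idP/idP; lia.
Qed.

End Coefficients.

Section Paths.
Context {R : realType} {V : completeNormedModType R} {T : tensor_powers V}.

Record control (w : R -> R -> R) : Prop := {
  control_ge0 : forall s t, 0 <= s -> s <= t -> t <= 1 -> 0 <= w s t;
  control_diag : forall t, 0 <= t -> t <= 1 -> w t t = 0;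
  control_superadd : forall s u t, 0 <= s -> s <= u -> u <= t -> t <= 1 ->
    w s u + w u t <= w s t;
  control_continuous :
    {within [set z : R * R | [/\ 0 <= z.1, z.1 <= z.2 & z.2 <= 1]],
      continuous (fun z : R * R => w z.1 z.2)} }.

(** [itv_partition a b D]: [a :: D] is strictly increasing and ends at [b]. *)
Definition partition_sum (G : nmodType) (a : R) (D : seq R) (F : R -> R -> G) : G :=
  \sum_(0 <= i < size D) F (nth a (a :: D) i) (nth a (a :: D) i.+1).

Definition mesh_lt (a : R) (D : seq R) (e : R) :=
  forall i, (i < size D)%N -> nth a (a :: D) i.+1 - nth a (a :: D) i < e.

Definition pvar (p : R) (X : R -> tseries T) (s t : R) : \bar R :=
  ereal_sup [set partition_sum s D (fun u v => (gdist (X u) (X v) `^ p)%E) |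
    D in itv_partition s t].

Definition geometric_rough_path (p : R) (X : R -> tseries T) :=
  (forall t, 0 <= t <= 1 -> grouplike (X t)) /\
  exists2 w, control w &
    forall s t, 0 <= s -> s <= t -> t <= 1 -> (pvar p X s t <= (w s t)%:E)%E.

Definition pincr (X : R -> tseries T) (s t : R) : tseries T := tsmul (tsinv (X s)) (X t).

(** The form attached to [X_t] is a function of [t]: if [X] revisits a point,
    [\int_0^t beta(X) dX] depends on [t] and not only on [X_t]. *)
Definition one_form (U : completeNormedModType R) (p : R) (beta : R -> eform T U) :=
  forall t, 0 <= t <= 1 -> is_eform (Num.truncn p) (beta t).

Definition defect (U : completeNormedModType R) (N : nat) (X : R -> tseries T)
    (beta : R -> eform T U) (s t : R) : eform T U :=
  fun k y => beta t k y - translate N (beta s) (pincr X s t) k y.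
Arguments defect U N X beta s t k y : clear implicits.
Arguments defect {U}.

(** Extended-real division: [0 / 0 = 0] and [a / 0 = +oo] for [0 < a]. *)
Definition slow_norm (U : completeNormedModType R) (p : R) (X : R -> tseries T)
    (beta : R -> eform T U) (w : R -> R -> R) (theta : R) : \bar R :=
  let N := Num.truncn p in
  let den k s t : R := w s t `^ (theta - k%:R / p) in
  let ratio k s t := (opnorm (defect N X beta s t k) / (den k s t)%:E)%E in
  adde (ereal_sup [set form_norm N (beta t) | t in [set t : R | 0 <= t <= 1]])
    (\big[maxe/0%E]_(1 <= k < N.+1)
      ereal_sup [set ratio k z.1 z.2 |
        z in [set z : R * R | [/\ 0 <= z.1, z.1 < z.2 & z.2 <= 1]]]).

Definition is_rough_integral (U : completeNormedModType R) (p : R) (X : R -> tseries T)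
    (beta : R -> eform T U) (t : R) (I : U) :=
  forall e, 0 < e -> exists2 d, 0 < d &
    forall D, itv_partition 0 t D -> mesh_lt 0 D d ->
      `|partition_sum 0 D
          (fun u v => form_eval (Num.truncn p) (beta u) (pincr X u v)) - I| < e.

Definition rough_integral (U : completeNormedModType R) (p : R) (X : R -> tseries T)
    (beta : R -> eform T U) (t : R) : U :=
  get (is_rough_integral p X beta t).

Definition iterated_form (U1 U2 : completeNormedModType R)
    (W : tensor_product U1 U2) (p : R) (X : R -> tseries T)
    (beta1 : R -> eform T U1) (beta2 : R -> eform T U2) : R -> eform T W :=
  fun t k y => tens_form W (rough_integral p X beta1 t) (beta2 t) k y
               + trunc_prod W (beta1 t) (beta2 t) k y.

End Paths.
Arguments iterated_form {R V T U1 U2} W p X beta1 beta2 t k y.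

(* Main.v *)
Require Import Defs.
From HB Require Import structures.
From mathcomp Require Import all_boot all_order all_algebra all_fingroup.
From mathcomp Require Import all_classical all_reals all_analysis.
From mathcomp Require Import zify ring lra.
Set Implicit Arguments.
Unset Strict Implicit.
Unset Printing Implicit Defensive.
Import Order.TTheory GRing.Theory Num.Theory.
Import numFieldNormedType.Exports.
Local Open Scope classical_set_scope.
Local Open Scope ring_scope.

(** By superadditivity of the controls, a partition of [s, t] can be split around one
    of its intervals so that either side carries at most half of the control; this
    gives the sewing estimate |I_t - I_s - beta1_s(X_{s,t})| <= C w(s,t)^theta.

    Group-likeness of b = X_{s,t} gives a Leibniz rule for the half-shuffle
    product: (phi > psi)(b^a y) is the sum over i + j = a of
    phi(b^i .) > psi(b^j .) evaluated at y.  If the value I_t of the integral is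
    adjoined to beta1 as its component of degree 0, the form beta is the single
    product beta1 > beta2, and its defect is
      (defect beta1) > beta2 + (beta1)_b > (defect beta2)
    plus the terms with i + j + k > [p] that are lost by truncation, which are
    of order w^{([p] + 1 - k)/p}.  In degree 0 the defect of beta1 is the sewing
    error.

    A shuffle is handled through its bit mask: tau^-1 moves the letters selected
    by the mask to the front, and masks of concatenated words are concatenations
    of masks. *)

(** * Bounded linear maps on tensor powers *)

(** The exponent in the conclusion is capped at ([p] + 1)/p, because the terms lost by truncation
    are of order w^{([p]+1-k)/p} and in general no better. Take p = 1, constant linear forms along a
    straight line, and controls proportional to t - s: the defects of beta1 and beta2 vanish, while
    that of beta is in general a nonzero multiple of t - s in degree 1, which forces theta - 1 <= 1.
    As ([p] + 1)/p > 1, the sewing estimate survives the cap.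

    The function w contains the p-variation, which is only known to be dominated by a control.
    Existence of the integral relies on continuity and is obtained from another control; the
    estimates in w rest on superadditivity and are applied to an integral already known to exist.

    The degree 0 component of beta2 is set to 0, and its defect in degree 0 is not small. This does
    no harm: the last letter of a half-shuffle belongs to the second factor, whose degree is
    therefore positive. *)

Section LinearMaps.
Context {R : realType}.
Implicit Types E F G : lmodType R.

Lemma linD E F (f : E -> F) : linear f -> {morph f : x y / x + y}.
Proof. by move=> lf x y; rewrite -[x]scale1r lf !scale1r. Qed.

Lemma lin0 E F (f : E -> F) : linear f -> f 0 = 0.
Proof. by move=> lf; apply: (@addrI _ (f 0)); rewrite -linD// !addr0. Qed.

Lemma linZ E F (f : E -> F) : linear f -> forall a x, f (a *: x) = a *: f x.
Proof. by move=> lf a x; rewrite -[a *: x]addr0 lf lin0// addr0. Qed.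

Lemma linN E F (f : E -> F) : linear f -> {morph f : x / - x}.
Proof. by move=> lf x; rewrite -scaleN1r linZ// scaleN1r. Qed.

Lemma linB E F (f : E -> F) : linear f -> {morph f : x y / x - y}.
Proof. by move=> lf x y; rewrite linD// linN. Qed.

Lemma lin_sum E F (f : E -> F) : linear f ->
  forall I (r : seq I) (P : pred I) (g : I -> E),
  f (\sum_(i <- r | P i) g i) = \sum_(i <- r | P i) f (g i).
Proof. by move=> lf I r P g; apply: big_morph; [exact: linD|exact: lin0]. Qed.

Lemma lin_comp E F G (f : F -> G) (g : E -> F) :
  linear f -> linear g -> linear (fun x => f (g x)).
Proof. by move=> lf lg a x y; rewrite lg lf. Qed.

Lemma linear_sum_fun E F I (r : seq I) (P : pred I) (f : I -> E -> F) :
  (forall i, P i -> linear (f i)) -> linear (fun x => \sum_(i <- r | P i) f i x).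
Proof.
move=> lf a x y; rewrite scaler_sumr -big_split /=.
by apply: eq_bigr => i Pi; rewrite lf.
Qed.

Lemma linear_add E F (f g : E -> F) :
  linear f -> linear g -> linear (fun x => f x + g x).
Proof. by move=> lf lg a x y; rewrite lf lg scalerDr addrACA. Qed.

Lemma linear_opp E F (f : E -> F) : linear f -> linear (fun x => - f x).
Proof. by move=> lf a x y; rewrite lf opprD scalerN. Qed.

Lemma linear_sub E F (f g : E -> F) :
  linear f -> linear g -> linear (fun x => f x - g x).
Proof. by move=> lf lg; apply: linear_add => //; exact: linear_opp. Qed.

Lemma linear_zero E F : linear (fun _ : E => 0 : F).
Proof. by move=> a x y; rewrite scaler0 addr0. Qed.

End LinearMaps.

(** Real constants keep the estimates out of the extended reals; [opnorm_le] and [lbound_opnorm]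
    translate to and from [opnorm]. *)
Definition lbound {R : realType} {E F : normedModType R} (f : E -> F) (c : R) :=
  forall x, `|f x| <= c * `|x|.

Section BoundedLinearMaps.
Context {R : realType}.
Implicit Types E F G : normedModType R.

Lemma lbound_clinear E F (f : E -> F) c : linear f -> lbound f c -> clinear f.
Proof.
move=> lf bf; split=> //.
pose f' : {linear E -> F} := HB.pack f (GRing.isLinear.Build _ _ _ _ f lf).
rewrite -[f]/(f' : E -> F); apply: bounded_linear_continuous.
apply/linear_boundedP; exists `|c|; split; first exact: normr_real.
move=> r cr x; apply: le_trans (bf x) _.
by rewrite ler_wpM2r// (le_trans (ler_norm _))// ltW.
Qed.

Lemma clinear_lbound E F (f : E -> F) :
  clinear f -> exists2 c, 0 <= c & lbound f c.
Proof.
move=> [lf cf].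
pose f' : {linear E -> F} := HB.pack f (GRing.isLinear.Build _ _ _ _ f lf).
have /continuous_linear_bounded/linear_boundedP[c [_ bf]] : {for 0, continuous f'}.
  exact: cf.
exists (`|c| + 1); first by rewrite addr_ge0.
by apply: bf; rewrite (le_lt_trans (ler_norm _))// ltrDl.
Qed.

Lemma lbound_le E F (f : E -> F) c d : lbound f c -> c <= d -> lbound f d.
Proof. by move=> bf cd x; rewrite (le_trans (bf x))// ler_wpM2r. Qed.

Lemma lbound_sum E F I (r : seq I) (P : pred I) (f : I -> E -> F) (c : I -> R) :
  (forall i, P i -> lbound (f i) (c i)) ->
  lbound (fun x => \sum_(i <- r | P i) f i x) (\sum_(i <- r | P i) c i).
Proof.
move=> bf x; rewrite (le_trans (ler_norm_sum _ _ _))// mulr_suml.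
by apply: ler_sum => i Pi; exact: bf.
Qed.

Lemma lbound_add E F (f g : E -> F) c d :
  lbound f c -> lbound g d -> lbound (fun x => f x + g x) (c + d).
Proof. by move=> bf bg x; rewrite (le_trans (ler_normD _ _))// mulrDl lerD. Qed.

Lemma lbound_opp E F (f : E -> F) c :
  lbound f c -> lbound (fun x => - f x) c.
Proof. by move=> bf x; rewrite normrN. Qed.

Lemma lbound_sub E F (f g : E -> F) c d :
  lbound f c -> lbound g d -> lbound (fun x => f x - g x) (c + d).
Proof. by move=> bf bg; apply: lbound_add => //; exact: lbound_opp. Qed.

Lemma lbound_comp E F G (f : F -> G) (g : E -> F) c d : 0 <= c ->
  lbound f c -> lbound g d -> lbound (fun x => f (g x)) (c * d).
Proof.
by move=> c0 bf bg x; rewrite (le_trans (bf _))// -mulrA ler_wpM2l.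
Qed.

Lemma clinear_comp E F G (f : F -> G) (g : E -> F) :
  clinear f -> clinear g -> clinear (fun x => f (g x)).
Proof.
move=> cf cg; have [c c0 bf] := clinear_lbound cf.
have [d d0 bg] := clinear_lbound cg.
by apply: (lbound_clinear _ (lbound_comp c0 bf bg)); apply: lin_comp;
  [case: cf|case: cg].
Qed.

Lemma clinear_sum E F I (r : seq I) (P : pred I) (f : I -> E -> F) :
  (forall i, P i -> clinear (f i)) ->
  clinear (fun x => \sum_(i <- r | P i) f i x).
Proof.
move=> cf; have /choice[c cP] : forall i, exists c, P i -> lbound (f i) c.
  move=> i; have [Pi|] := boolP (P i); last by exists 0.
  by have [c _ bc] := clinear_lbound (cf i Pi); exists c.
apply: (@lbound_clinear _ _ _ (\sum_(i <- r | P i) c i)).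
  by apply: linear_sum_fun => i /cf[].
exact: lbound_sum.
Qed.

Lemma clinear_sub E F (f g : E -> F) :
  clinear f -> clinear g -> clinear (fun x => f x - g x).
Proof.
move=> [lf cf] [lg cg]; split; first exact: linear_sub.
by move=> x; apply: cvgB; [exact: cf|exact: cg].
Qed.

Lemma clinear_zero E F : clinear (fun _ : E => 0 : F).
Proof. by split; [exact: linear_zero|exact: cst_continuous]. Qed.

Lemma opnorm_ge0 E F (f : E -> F) : (0 <= opnorm f)%E.
Proof.
apply: (@le_trans _ _ (`|f 0|%:E)); first by rewrite lee_fin.
by apply: ereal_sup_ubound; exists 0 => //=; rewrite normr0.
Qed.

Lemma opnorm_le E F (f : E -> F) (c : R) :
  0 <= c -> lbound f c -> (opnorm f <= c%:E)%E.
Proof.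
move=> c0 bf; apply: ge_ereal_sup => _ [x /= x1 <-]; rewrite lee_fin.
by rewrite (le_trans (bf x))// ler_piMr.
Qed.

Lemma lbound_opnorm E F (f : E -> F) (c : R) :
  linear f -> (opnorm f <= c%:E)%E -> lbound f c.
Proof.
move=> lf fc x; have [->|x0] := eqVneq x 0; first by rewrite lin0// !normr0 mulr0.
have nx : 0 < `|x| by rewrite normr_gt0.
rewrite -ler_pdivrMr// mulrC -[`|x|^-1]gtr0_norm ?invr_gt0// -normrZ -(linZ lf).
rewrite -lee_fin (le_trans _ fc)//; apply: ereal_sup_ubound.
exists (`|x|^-1 *: x) => //=.
by rewrite normrZ gtr0_norm ?invr_gt0// mulVf// gt_eqF.
Qed.

End BoundedLinearMaps.

(** * Continuous linear maps determined by pure tensors *)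

Section Density.
Context {R : realType} {V : completeNormedModType R} {T : tensor_powers V}.
Implicit Types E : normedModType R.

Lemma clinear_tpure0 E k (f : T k -> E) : clinear f ->
  (forall v, f (tpure T v) = 0) -> forall x, f x = 0.
Proof.
move=> cf fv x; have [c c0 bf] := clinear_lbound cf; have [lf _] := cf.
have fs s : f (\sum_(q <- s) q.1 *: @tpure R V T k q.2) = 0.
  by rewrite (lin_sum lf) big1// => q _; rewrite (linZ lf) fv scaler0.
apply/eqP; rewrite -normr_le0; apply/ler_addgt0Pr => e e0; rewrite add0r.
(* The summand 1 covers c = 0; the error c * e / (c + 1) is at most e. *)
have d0 : 0 < e / (c + 1) by rewrite divr_gt0// ltr_wpDl.
have xB : ball x (e / (c + 1)) !=set0 by exists x; exact: ballxx.
have [y [xy [s _ ys]]] := tpure_dense xB (ball_open x _).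
move: xy; rewrite -ball_normE /ball_ /= -ys => xy.
have -> : f x = f (x - \sum_(q <- s) q.1 *: @tpure R V T k q.2).
  by rewrite (linB lf) fs subr0.
rewrite (le_trans (bf _))// (@le_trans _ _ (c * (e / (c + 1))))//.
  by rewrite ler_wpM2l// ltW.
rewrite mulrCA ler_piMr ?ltW// ltr_pdivrMr ?mul1r; lra.
Qed.

Lemma clinear_tpure_eq E k (f g : T k -> E) : clinear f -> clinear g ->
  (forall v, f (tpure T v) = g (tpure T v)) -> forall x, f x = g x.
Proof.
move=> cf cg fg x; apply/eqP; rewrite -subr_eq0; apply/eqP.
by apply: (clinear_tpure0 (clinear_sub cf cg)) => v; rewrite fg subrr.
Qed.

(** Lists instead of tuples: the degree is read off the list, so that forms can be evaluated on
    concatenated and masked words without casts. *)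
Definition tlist (l : seq V) : T (size l) := tpure T (in_tuple l).

Lemma tlist_ind (Q : forall k, T k -> Prop) :
  (forall l, Q (size l) (tlist l)) -> forall k (v : k.-tuple V), Q k (tpure T v).
Proof.
move=> Ql k [l e]; have := Ql l; rewrite /tlist.
have eq : size l = k by apply/eqP.
by case: _ / eq e => e; congr Q; congr tpure; exact: val_inj.
Qed.

(** Whole families are compared because [tlist T l] has degree [size l], equal to [k] only
    propositionally; evaluating at degree [size l] avoids a transport. *)
Lemma clinear_tlist_eq (E : normedModType R) (f g : forall k, T k -> E) k :
  clinear (f k) -> clinear (g k) ->
  (forall l, size l = k -> f (size l) (tlist l) = g (size l) (tlist l)) ->
  forall x, f k x = g k x.
Proof.
move=> cf cg fg; apply: clinear_tpure_eq => // v.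
have := @tlist_ind (fun n x => n = k -> f n x = g n x).
by move=> /(_ fg k v erefl).
Qed.

End Density.
Arguments tlist {R V} T l.

(** * The algebra of tensor series *)

(** The index m may lie outside the range provided its term is zero; for products of homogeneous
    components this is the case of too large a degree. *)
Lemma sum_collapse (G : nmodType) (M m : nat) (x : G) :
  ((M <= m)%N -> x = 0) -> \sum_(l < M) (if m == l then x else 0) = x.
Proof.
move=> x0; have [mM|mM] := ltnP m M.
  rewrite (bigD1 (Ordinal mM)) //= eqxx big1 ?addr0// => l.
  by rewrite eq_sym -val_eqE /= => /negbTE ->.
by rewrite x0// big1// => l _; rewrite if_same.
Qed.

Section TensorSeries.
Context {R : realType} {V : completeNormedModType R} {T : tensor_powers V}.

Lemma tmul0l m n (y : T n) : tmul (0 : T m) y = 0.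
Proof. exact: (lin0 ((tmul_bilin T m n).2 y)). Qed.

Lemma tmul0r m n (x : T m) : tmul x (0 : T n) = 0.
Proof. exact: (lin0 ((tmul_bilin T m n).1 x)). Qed.

Lemma lbound_tmul m n (x : T m) : lbound (fun y : T n => tmul x y) `|x|.
Proof. by move=> y; exact: norm_tmul. Qed.

Lemma clinear_tmul m n (x : T m) : clinear (fun y : T n => tmul x y).
Proof. exact: (lbound_clinear ((tmul_bilin T m n).1 x) (@lbound_tmul m n x)). Qed.

Lemma clinear_tmull m n (y : T n) : clinear (fun x : T m => tmul x y).
Proof.
apply: (@lbound_clinear _ _ _ _ `|y|); first exact: (tmul_bilin T m n).2.
by move=> x; rewrite mulrC; exact: norm_tmul.
Qed.

Lemma clinear_tcastp m n (e : m = n) : clinear (tcastp e : T m -> T n).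
Proof.
apply: (@lbound_clinear _ _ _ _ 1); first exact: tcastp_linear.
by move=> x; rewrite norm_tcastp mul1r.
Qed.

Lemma tpure_eq m n (v : m.-tuple V) (w : n.-tuple V) (e : m = n) :
  v = w :> seq V -> tcastp e (tpure T v) = tpure T w.
Proof.
by case: _ / e w => w vw; congr tpure; exact: val_inj.
Qed.

Lemma tmul_assoc l m n (x : T l) (y : T m) (z : T n) :
  tcastp (addnA l m n) (tmul x (tmul y z)) = tmul (tmul x y) z.
Proof.
move: x; apply: clinear_tpure_eq.
- apply: (@clinear_comp _ _ _ _ (tcastp (addnA l m n)) (fun x => tmul x _)).
    exact: clinear_tcastp.
  exact: clinear_tmull.
- apply: (@clinear_comp _ _ _ _ (fun x => tmul x z) (fun x => tmul x y));
  exact: clinear_tmull.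
move=> u; move: y; apply: clinear_tpure_eq.
- apply: (@clinear_comp _ _ _ _ (tcastp (addnA l m n)) (fun y => tmul _ (tmul y z))).
    exact: clinear_tcastp.
  apply: (@clinear_comp _ _ _ _ (fun y => tmul _ y) (fun y => tmul y z)).
    exact: clinear_tmul.
  exact: clinear_tmull.
- apply: (@clinear_comp _ _ _ _ (fun x => tmul x z) (fun y => tmul _ y)).
    exact: clinear_tmull.
  exact: clinear_tmul.
move=> v; move: z; apply: clinear_tpure_eq.
- apply: (@clinear_comp _ _ _ _ (tcastp (addnA l m n)) (fun y => tmul _ (tmul _ y))).
    exact: clinear_tcastp.
  apply: (@clinear_comp _ _ _ _ (fun y => tmul _ y) (fun y => tmul _ y));
  exact: clinear_tmul.
- exact: clinear_tmul.
move=> w; rewrite !tmul_tpure; apply: tpure_eq => /=.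
by rewrite catA.
Qed.

(** A cast without proof argument, zero when the degrees differ. Products bracketed differently live
    in types that are only propositionally equal; this makes them comparable. *)
Definition tproj n m (x : T m) : T n :=
  if m =P n is ReflectT e then tcastp e x else 0.

Lemma tproj_eq n m (e : m = n) (x : T m) : tproj n x = tcastp e x.
Proof.
by rewrite /tproj; case: eqP => [e'|//]; rewrite (eq_irrelevance e e').
Qed.

Lemma tproj_neq n m (x : T m) : m != n -> tproj n x = 0.
Proof. by rewrite /tproj; case: eqP. Qed.

Lemma tproj_id n (x : T n) : tproj n x = x.
Proof. by rewrite (tproj_eq (erefl n)). Qed.

Lemma tproj_tcastp n l m (e : l = m) (x : T l) : tproj n (tcastp e x) = tproj n x.
Proof. by case: _ / e. Qed.

Lemma tproj_linear n m : linear (@tproj n m).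
Proof.
have [e|mn] := eqVneq m n.
  by move=> a x y; rewrite !(tproj_eq e) tcastp_linear.
by move=> a x y; rewrite !tproj_neq// scaler0 addr0.
Qed.

Lemma tproj_tmull n l m k (x : T m) (y : T k) :
  tproj n (tmul (tproj l x) y) = if m == l then tproj n (tmul x y) else 0.
Proof.
case: (eqVneq m l) => [e|ml]; last first.
  by rewrite (tproj_neq x)// tmul0l (lin0 (@tproj_linear _ _)).
by case: _ / e; rewrite tproj_id.
Qed.

Lemma tproj_tmulr n l m k (x : T m) (y : T k) :
  tproj n (tmul x (tproj l y)) = if k == l then tproj n (tmul x y) else 0.
Proof.
case: (eqVneq k l) => [e|ml]; last first.
  by rewrite (tproj_neq y)// tmul0r (lin0 (@tproj_linear _ _)).
by case: _ / e; rewrite tproj_id.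
Qed.

Lemma tproj_tmulA n l m k (x : T l) (y : T m) (z : T k) :
  tproj n (tmul x (tmul y z)) = tproj n (tmul (tmul x y) z).
Proof.
by rewrite -tmul_assoc tproj_tcastp.
Qed.

Lemma tproj_tmul1l n m (x : T m) :
  tproj n (tmul (tpure T [tuple]) x) = tproj n x.
Proof.
congr tproj; move: x; apply: clinear_tpure_eq; first exact: clinear_tmul.
  by apply: (@lbound_clinear _ _ _ _ 1) => // x; rewrite mul1r.
move=> v; rewrite tmul_tpure.
by apply: (@tpure_eq _ _ _ _ erefl).
Qed.

Lemma tproj_tmul1r n m (x : T m) :
  tproj n (tmul x (tpure T [tuple])) = tproj n x.
Proof.
by rewrite -[in RHS](tmulx1 x) tproj_tcastp.
Qed.

(* Junk terms of the wrong degree vanish, so that the ranges of both indices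
   are independent of each other. *)
Lemma tsmulE (a b : tseries T) n M : (n < M)%N ->
  tsmul a b n = \sum_(i < M) \sum_(j < M) tproj n (tmul (a i) (b j)).
Proof.
move=> nM; transitivity (\sum_(i < n.+1) tproj n (tmul (a i) (b (n - i)%N))).
  by apply: eq_bigr => i _; rewrite (tproj_eq (subnKC (leq_ord i))).
rewrite (big_ord_widen M (fun i => tproj n (tmul (a i) (b (n - i)%N)))) //.
rewrite big_mkcond /=; apply: eq_bigr => i _.
case: ifPn => [iltn|]; last first.
  rewrite -leqNgt => ni; rewrite big1// => j _.
  by rewrite tproj_neq//; lia.
have jM : (n - i < M)%N by lia.
rewrite (bigD1 (Ordinal jM)) //= big1 ?addr0// => j ij.
rewrite tproj_neq//; apply: contra ij => /eqP ijn; apply/eqP/val_inj => /=.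
lia.
Qed.

Lemma tsmulA (a b c : tseries T) : tsmul (tsmul a b) c = tsmul a (tsmul b c).
Proof.
apply: functional_extensionality_dep => n; pose M := n.+1.
pose F (i j k : nat) := tproj n (tmul (tmul (a i) (b j)) (c k)).
transitivity (\sum_(i < M) \sum_(j < M) \sum_(k < M) F i j k).
  rewrite (tsmulE _ _ (ltnSn n)).
  transitivity (\sum_(l < M) \sum_(k < M) \sum_(i < M) \sum_(j < M)
      if (i + j == l)%N then F i j k else 0).
    apply: eq_bigr => l _; apply: eq_bigr => k _.
    rewrite (tsmulE _ _ (ltn_ord l)).
    have lin : linear (fun x : T l => tproj n (tmul x (c k))).
      by apply: lin_comp; [exact: tproj_linear|exact: (tmul_bilin T l k).2].
    rewrite (lin_sum lin); apply: eq_bigr => i _.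
    by rewrite (lin_sum lin); apply: eq_bigr => j _; rewrite tproj_tmull.
  transitivity (\sum_(k < M) \sum_(i < M) \sum_(j < M) F i j k); last first.
    by rewrite exchange_big /=; apply: eq_bigr => i _; rewrite exchange_big.
  rewrite exchange_big /=; apply: eq_bigr => k _.
  rewrite exchange_big /=; apply: eq_bigr => i _.
  rewrite exchange_big /=; apply: eq_bigr => j _.
  by rewrite sum_collapse// => ijM; rewrite /F tproj_neq//; lia.
rewrite (tsmulE _ _ (ltnSn n)); apply: eq_bigr => i _.
transitivity (\sum_(l < M) \sum_(j < M) \sum_(k < M)
    if (j + k == l)%N then F i j k else 0).
  symmetry; rewrite exchange_big /=; apply: eq_bigr => j _.
  rewrite exchange_big /=; apply: eq_bigr => k _.
  by rewrite sum_collapse// => ijM; rewrite /F tproj_neq//; lia.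
apply: eq_bigr => l _; rewrite (tsmulE _ _ (ltn_ord l)).
have lin : linear (fun x : T l => tproj n (tmul (a i) x)).
  by apply: lin_comp; [exact: tproj_linear|exact: (tmul_bilin T i l).1].
rewrite (lin_sum lin); apply: eq_bigr => j _.
rewrite (lin_sum lin); apply: eq_bigr => k _.
by rewrite tproj_tmulr tproj_tmulA.
Qed.

Lemma tsmul1s (a : tseries T) : tsmul tsone a = a.
Proof.
apply: functional_extensionality_dep => n.
rewrite (tsmulE _ _ (ltnSn n)) big_ord_recl [X in _ + X]big1 ?addr0; last first.
  by move=> i _; rewrite big1// => j _; rewrite tmul0l (lin0 (@tproj_linear _ _)).
rewrite (bigD1 ord_max) //= tproj_tmul1l tproj_id big1 ?addr0// => j jn.
by rewrite tproj_tmul1l tproj_neq//; apply: contra jn => /eqP jn; apply/eqP/val_inj.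
Qed.

Lemma tsmuls1 (a : tseries T) : tsmul a tsone = a.
Proof.
apply: functional_extensionality_dep => n.
rewrite (tsmulE _ _ (ltnSn n)) exchange_big /= big_ord_recl [X in _ + X]big1 ?addr0; last first.
  by move=> i _; rewrite big1// => j _; rewrite tmul0r (lin0 (@tproj_linear _ _)).
rewrite (bigD1 ord_max) //= tproj_tmul1r tproj_id big1 ?addr0// => j jn.
by rewrite tproj_tmul1r tproj_neq//; apply: contra jn => /eqP jn; apply/eqP/val_inj.
Qed.

Lemma tsmul_rec (b a : tseries T) n : a 0%N = tpure T [tuple] ->
  tsmul b a n = b n + \sum_(i < n) tproj n (tmul (b i) (a (n - i)%N)).
Proof.
move=> a0; rewrite /tsmul big_ord_recr /= addrC; congr (_ + _); last first.
  by apply: eq_bigr => i _; rewrite (tproj_eq (subnKC (ltnW (ltn_ord i))));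
     congr tcastp; exact: eq_irrelevance.
rewrite -(tproj_eq (subnKC (leq_ord ord_max))) /=.
have E : (n - n = 0)%N by rewrite subnn.
by rewrite E a0 tproj_tmul1r tproj_id.
Qed.

Lemma tsmul_0 (a b : tseries T) : a 0%N = tpure T [tuple] ->
  b 0%N = tpure T [tuple] -> tsmul a b 0%N = tpure T [tuple].
Proof. by move=> a0 b0; rewrite tsmul_rec// big_ord0 addr0. Qed.

(** By [tsmul_rec], the degree n part of b a = 1 expresses b^n through lower degrees. Strong
    recursion over dependent degrees is avoided by iterating [step] on whole series: degree k is
    stationary from the k-th iterate on, so the solution is the diagonal of the iterates. *)
Lemma tsinv_left_exists (a : tseries T) : a 0%N = tpure T [tuple] ->
  exists2 b, tsmul b a = tsone & b 0%N = tpure T [tuple].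
Proof.
move=> a0.
pose step (b : tseries T) : tseries T :=
  fun n => tsone n - \sum_(i < n) tproj n (tmul (b i) (a (n - i)%N)).
pose B n := iter n step tsone.
have stab n k : (k <= n)%N -> B n.+1 k = B n k.
  elim: n k => [|n IH] k kn.
    by move: kn; rewrite leqn0 => /eqP ->; rewrite /B /= /step big_ord0 subr0.
  rewrite [in LHS]/B iterS -/(B n.+1) [in RHS]/B iterS -/(B n) /step.
  by congr (_ - _); apply: eq_bigr => i _; rewrite IH//; have := ltn_ord i; lia.
have stab' n k : (k <= n)%N -> B n k = B k k.
  elim: n => [|n IH]; first by rewrite leqn0 => /eqP ->.
  by rewrite leq_eqVlt => /predU1P[->//|]; rewrite ltnS => kn; rewrite stab// IH.
pose b : tseries T := fun n => B n n.
have b0 : b 0%N = tpure T [tuple] by [].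
exists b => //; apply: functional_extensionality_dep => n.
rewrite tsmul_rec// {1}/b -stab// [B n.+1]/B iterS -/(B n) /step.
rewrite (eq_bigr (fun i : 'I_n => tproj n (tmul (b i) (a (n - i)%N)))) ?subrK//.
by move=> i _; rewrite stab'// ltnW.
Qed.

(** A left inverse b of a has a left inverse in turn, which must be a; so b is two-sided, and the
    series picked by [get] can only be b. *)
Lemma tsinvP (a : tseries T) : a 0%N = tpure T [tuple] ->
  [/\ tsmul (tsinv a) a = tsone, tsmul a (tsinv a) = tsone
    & tsinv a 0%N = tpure T [tuple]].
Proof.
move=> a0; have [b ba b0] := tsinv_left_exists a0.
have [c cb c0] := tsinv_left_exists b0.
have ca : c = a by rewrite -[c]tsmuls1 -ba -tsmulA cb tsmul1s.
have ab : tsmul a b = tsone by rewrite -{1}ca.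
have [ai ia] : [set b | tsmul a b = tsone /\ tsmul b a = tsone] (tsinv a).
  by rewrite /tsinv; apply: getPex; exists b.
split=> //; suff -> : tsinv a = b by [].
by rewrite -[tsinv a]tsmul1s -ba tsmulA ai tsmuls1.
Qed.

End TensorSeries.

(** * Shuffles as bit masks *)

Fixpoint masks (N : nat) : seq bitseq :=
  if N is N'.+1 then map (cons true) (masks N') ++ map (cons false) (masks N')
  else [:: [::]].

Lemma mem_masks N mu : (mu \in masks N) = (size mu == N).
Proof.
elim: N mu => [|N IH] [|b mu] //=; rewrite mem_cat.
  by apply/negbTE; rewrite negb_or; apply/andP; split; apply/mapP => -[].
rewrite eqSS -IH; apply/orP/idP => [[]/mapP[nu nuN [_ ->]]//|muN].
by case: b; [left|right]; rewrite map_f.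
Qed.

Lemma masks_uniq N : uniq (masks N).
Proof.
elim: N => [//|N IH] /=; rewrite cat_uniq !map_inj_uniq ?IH ?andbT; try by move=> ? ? [].
by apply/hasPn => _ /mapP[nu _ ->]; apply/mapP => -[].
Qed.

Lemma big_masks_cat (G : nmodType) a k (F : bitseq -> G) :
  \sum_(mu <- masks (a + k)) F mu =
  \sum_(mu1 <- masks a) \sum_(mu2 <- masks k) F (mu1 ++ mu2).
Proof.
elim: a F => [|a IH] F; first by rewrite big_seq1.
by rewrite addSn /= !big_cat !big_map /= !IH.
Qed.

Lemma perm_mask_cat (A : eqType) (s : seq A) mu : size mu = size s ->
  perm_eq (mask mu s ++ mask (map negb mu) s) s.
Proof.
elim: s mu => [|x s IH] [|b mu] //= [/IH pe].
case: b => /=; first by rewrite perm_cons.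
by rewrite -cat1s perm_catCA /= perm_cons.
Qed.

Lemma map_ltn_mask n (w : seq nat) mu : size mu = size w ->
  all (fun x => x < n)%N (mask mu w) ->
  all (fun x => n <= x)%N (mask (map negb mu) w) ->
  [seq (x < n)%N | x <- w] = mu.
Proof.
elim: w mu => [|x w IH] [|b mu] //= [/IH{}IH].
case: b => /=; first by move=> /andP[-> /IH{}IH] /IH ->.
by move=> /IH{}IH /andP[nx] /IH ->; rewrite ltnNge nx.
Qed.

(* A shuffle is determined by the positions of the letters of its first word:
   [tau^-1] moves the letters at these positions to the front. *)
Section ShuffleMasks.
Context (n m : nat).
Implicit Type tau : 'S_(n + m).

Definition shmask tau : bitseq := [seq (x < n)%N | x <- pword tau].

Lemma pword_uniq tau : uniq (pword tau).
Proof. by rewrite map_inj_uniq ?enum_uniq// => i j /val_inj/perm_inj. Qed.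

Lemma pword_lt tau x : x \in pword tau -> (x < n + m)%N.
Proof. by move=> /mapP[i _ ->]; exact: ltn_ord. Qed.

Lemma size_pword tau : size (pword tau) = (n + m)%N.
Proof. by rewrite size_map size_enum_ord. Qed.

(** Letters do not repeat in the word of a permutation, so a subsequence of it is the filter by its
    own letters. *)
Lemma Sh_filter tau : tau \in Sh n m ->
  [seq x <- pword tau | (x < n)%N] = iota 0 n /\
  [seq x <- pword tau | (n <= x)%N] = iota n m.
Proof.
rewrite inE => /andP[s1 s2]; have u := pword_uniq tau.
rewrite [RHS](elimT (subseq_uniqP u) s1).
rewrite [X in _ /\ _ = X](elimT (subseq_uniqP u) s2).
split; first by apply: eq_filter => x; rewrite mem_iota.
by apply: eq_in_filter => x /pword_lt xnm; rewrite mem_iota xnm andbT.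
Qed.

Lemma enum_ord_filter :
  [seq i : 'I_(n + m) <- enum 'I_(n + m) | (i < n)%N] ++
  [seq i : 'I_(n + m) <- enum 'I_(n + m) | (n <= i)%N]
    = enum 'I_(n + m) /\
  map val [seq i : 'I_(n + m) <- enum 'I_(n + m) | (i < n)%N] = iota 0 n /\
  map val [seq i : 'I_(n + m) <- enum 'I_(n + m) | (n <= i)%N] = iota n m.
Proof.
have E1 : map val [seq i : 'I_(n + m) <- enum 'I_(n + m) | (i < n)%N] = iota 0 n.
  rewrite -(filter_map val (fun x => x < n)%N) val_enum_ord iotaD filter_cat.
  rewrite (eq_in_filter (a2 := predT)) ?filter_predT; last by move=> x; rewrite mem_iota.
  rewrite (eq_in_filter (a2 := pred0)) ?filter_pred0 ?cats0// => x.
  by rewrite mem_iota /= => /andP[]; lia.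
have E2 : map val [seq i : 'I_(n + m) <- enum 'I_(n + m) | (n <= i)%N] = iota n m.
  rewrite -(filter_map val (fun x => n <= x)%N) val_enum_ord iotaD filter_cat.
  rewrite (eq_in_filter (a2 := pred0)) ?filter_pred0 /=; last first.
    by move=> x; rewrite mem_iota /=; lia.
  rewrite (eq_in_filter (a2 := predT)) ?filter_predT//.
  by move=> x; rewrite mem_iota => /andP[].
split=> //; apply: (inj_map val_inj); rewrite map_cat E1 E2 val_enum_ord.
by rewrite [RHS]iotaD.
Qed.

(** The i-th factor after the action of [tau^-1] is the one at the position of the letter i in the
    word of [tau]. In a shuffle the letters below n, and the others, occur in increasing order, so
    the mask and its complement read off these positions in the right order. *)
Lemma Sh_act (A : Type) tau (v : (n + m).-tuple A) : tau \in Sh n m ->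
  [seq tnth v (tau^-1%g i) | i <- enum 'I_(n + m)] =
  mask (shmask tau) v ++ mask (map negb (shmask tau)) v.
Proof.
move=> /Sh_filter[f1 f2]; have [E [E1 E2]] := enum_ord_filter.
have key (p : pred nat) : [seq x <- pword tau | p x] =
    map val [seq i : 'I_(n + m) <- enum 'I_(n + m) | p (val i)] ->
    mask (map p (pword tau)) v =
    [seq tnth v (tau^-1%g i) | i <- [seq i : 'I_(n + m) <- enum 'I_(n + m) | p (val i)]].
  move=> fp; rewrite /pword -map_comp.
  have -> : v = [seq tnth v i | i <- enum 'I_(n + m)] :> seq A by rewrite map_tnth_enum.
  rewrite -map_mask -filter_mask (map_comp (tnth v) (tau^-1)%g); congr (map (tnth v) _).
    apply: (inj_map (@perm_inj _ tau)); apply: (inj_map val_inj).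
  rewrite [in RHS](mapK (permKV tau)) -fp /pword filter_map.
  by rewrite -[in LHS]map_comp.
rewrite -[in LHS]E map_cat -(key (fun x => x < n)%N) ?f1//.
rewrite -(key (fun x => n <= x)%N) ?f2// /shmask; congr (_ ++ _).
by rewrite -[in RHS]map_comp; congr mask; apply: eq_map => x /=; rewrite leqNgt.
Qed.

Lemma shmask_inj : {in Sh n m &, injective shmask}.
Proof.
(* Acting on the tuple of all indices recovers [tau^-1] from the mask. *)
move=> t t' tS t'S tt'; have := Sh_act (ord_tuple (n + m)) t'S.
rewrite -tt' -(Sh_act (ord_tuple (n + m)) tS) => /eq_in_map E.
apply: invg_inj; apply/permP => i; have := E i; rewrite mem_enum => /(_ isT).
by rewrite !tnth_ord_tuple.
Qed.

Lemma shmask_onto mu : size mu = (n + m)%N -> count id mu = n ->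
  exists2 tau, tau \in Sh n m & shmask tau = mu.
Proof.
move=> smu cmu; pose s := enum 'I_(n + m).
have ss : size mu = size s by rewrite smu size_enum_ord.
(* [l] lists the selected positions first; the wanted shuffle has at each position the index of that
   position in [l]. *)
pose l := mask mu s ++ mask (map negb mu) s.
have pl : perm_eq l s by exact: perm_mask_cat.
have ul : uniq l by rewrite (perm_uniq pl) enum_uniq.
have memls x : x \in l by rewrite (perm_mem pl) mem_enum.
have sl : size l = (n + m)%N by rewrite (perm_size pl) size_enum_ord.
have il x : (index x l < n + m)%N by have := memls x; rewrite -index_mem sl.
have finj : injective (fun x => Ordinal (il x)).
  by move=> x y /(congr1 val) /= xy; rewrite -(nth_index x (memls x)) xy nth_index.
have wE : pword (perm finj) = [seq index x l | x <- s].
  by apply: eq_map => x /=; rewrite permE.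
have idx : [seq index x l | x <- l] = iota 0 (n + m).
  apply: (@eq_from_nth _ 0%N); rewrite size_map sl ?size_iota// => i inm.
  have x0 : 'I_(n + m) := Ordinal inm.
  by rewrite (nth_map x0) ?sl// nth_iota// index_uniq ?sl.
have s1 : size (mask mu s) = n by rewrite size_mask.
have m1 : mask mu (pword (perm finj)) = iota 0 n.
  rewrite wE -map_mask -[LHS](take_size_cat [seq index x l | x <- mask (map negb mu) s] (erefl _)).
  by rewrite -map_cat idx size_map s1 iotaD take_size_cat ?size_iota.
have m2 : mask (map negb mu) (pword (perm finj)) = iota n m.
  rewrite wE -map_mask -[LHS](@drop_size_cat _ n [seq index x l | x <- mask mu s]) ?size_map//.
  by rewrite -map_cat idx iotaD drop_size_cat ?size_iota.
exists (perm finj).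
  by rewrite inE -{1}m1 -m2 !mask_subseq.
apply: map_ltn_mask; first by rewrite size_pword.
  by rewrite m1; apply/allP => x; rewrite mem_iota.
by rewrite m2; apply/allP => x; rewrite mem_iota => /andP[].
Qed.

Lemma size_shmask tau : size (shmask tau) = (n + m)%N.
Proof. by rewrite size_map size_pword. Qed.

Lemma count_shmask tau : tau \in Sh n m -> count id (shmask tau) = n.
Proof.
move=> /Sh_filter[f1 _]; rewrite count_map -[RHS](size_iota 0 n) -f1.
by rewrite size_filter; apply: eq_count.
Qed.

(** The last letter of the word ends one of the two shuffled words; if it comes from the second, it
    is [(n + m).-1], letters being numbered from 0. *)
Lemma last_shmask tau : (0 < m)%N -> tau \in Sh n m ->
  (last 0%N (pword tau) == (n + m).-1) = ~~ last true (shmask tau).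
Proof.
move=> m0 /Sh_filter[_]; have := size_pword tau; rewrite /shmask.
case/lastP: (pword tau) => [|s x _]; first by rewrite -(prednK m0) addnS.
rewrite map_rcons !last_rcons -leqNgt filter_rcons; case: ifP => [nx|nx _].
  move=> /(congr1 (last 0%N)); rewrite last_rcons => ->.
  by rewrite -nth_last size_iota nth_iota ?prednK//; apply/eqP; lia.
by apply/negbTE; apply: contraFN nx => /eqP ->; lia.
Qed.

Lemma sum_shuffles (G : nmodType) (half : bool) (F : bitseq -> G) :
  (half -> (0 < m)%N) ->
  \sum_(tau in if half then Shlast n m else Sh n m) F (shmask tau) =
  \sum_(mu <- masks (n + m) | (count id mu == n) && (half ==> ~~ last true mu)) F mu.
Proof.
move=> m0; pose P mu := half ==> ~~ last true mu.
transitivity (\sum_(tau in Sh n m | P (shmask tau)) F (shmask tau)).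
  apply: eq_bigl => tau; rewrite {}/P; case: half m0 => /= [/(_ isT) m0|_]; last by rewrite andbT.
  by rewrite inE; case: (boolP (tau \in Sh n m)) => //= tS; rewrite last_shmask.
rewrite big_mkcondr /= -big_enum /= -(big_map shmask predT (fun mu => if P mu then F mu else 0)).
rewrite [RHS]big_mkcondr /= -[RHS]big_filter; apply: perm_big; apply: uniq_perm.
- by rewrite map_inj_in_uniq ?enum_uniq// => x y; rewrite !mem_enum; exact: shmask_inj.
- by rewrite filter_uniq// masks_uniq.
move=> mu; rewrite mem_filter mem_masks; apply/mapP/andP => [[tau]|[/eqP c /eqP s]].
  by rewrite mem_enum => tS ->; rewrite size_shmask count_shmask.
by have [tau tS E] := shmask_onto s c; exists tau; rewrite ?mem_enum.
Qed.

End ShuffleMasks.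

(** * Shuffle products of forms *)

Section IndexSums.
Context (G : nmodType).

Lemma sum_antidiag (F : nat -> nat -> G) k M : (k < M)%N ->
  \sum_(i < k.+1) F i (k - i)%N =
  \sum_(i < M) \sum_(j < M) if (i + j)%N == k then F i j else 0.
Proof.
move=> kM; rewrite (big_ord_widen M (fun i => F i (k - i)%N))//.
rewrite big_mkcond /=; apply: eq_bigr => i _; case: ifPn => ik.
  have jM : (k - i < M)%N by lia.
  rewrite (bigD1 (Ordinal jM)) //= subnKC// eqxx big1 ?addr0// => j ij.
  by rewrite ifF//; apply: contraNF ij => /eqP ijn; apply/eqP/val_inj => /=; lia.
by rewrite big1// => j _; rewrite ifF//; apply/negbTE; lia.
Qed.

Lemma sum_antidiag_trunc (F : nat -> nat -> G) m n : (m <= n)%N ->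
  \sum_(a < m.+1) \sum_(i < a.+1) F i (a - i)%N =
  \sum_(i < n.+1) \sum_(j < n.+1) if (i + j <= m)%N then F i j else 0.
Proof.
move=> mn.
transitivity (\sum_(a < m.+1) \sum_(i < n.+1) \sum_(j < n.+1)
    if (i + j)%N == a then F i j else 0).
  apply: eq_bigr => a _; apply: sum_antidiag.
  by rewrite (leq_trans (ltn_ord a))// ltnS.
rewrite exchange_big; apply: eq_bigr => i _; rewrite exchange_big; apply: eq_bigr => j _ /=.
case: leqP => ijm.
  rewrite (bigD1 (Ordinal (ijm : (i + j < m.+1)%N))) //= eqxx big1 ?addr0// => l.
  by rewrite eq_sym -val_eqE /= => /negbTE ->.
by rewrite big1// => l _; rewrite ifF//; apply/negbTE; have := ltn_ord l; lia.
Qed.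

Lemma sum_quad (F : nat -> nat -> nat -> nat -> G) k :
  \sum_(l < k.+1) \sum_(i < l.+1) \sum_(j < (k - l).+1) F i (l - i)%N j (k - l - j)%N =
  \sum_(i < k.+1) \sum_(i' < k.+1) \sum_(j < k.+1) \sum_(j' < k.+1)
    if (i + i' + j + j')%N == k then F i i' j j' else 0.
Proof.
pose H l i i' := \sum_(j < (k - l).+1) F i i' j (k - l - j)%N.
transitivity (\sum_(l < k.+1) \sum_(i < k.+1) \sum_(i' < k.+1)
    if (i + i')%N == l then H l i i' else 0).
  by apply: eq_bigr => l _; rewrite -sum_antidiag.
rewrite exchange_big; apply: eq_bigr => i _.
rewrite exchange_big; apply: eq_bigr => i' _ /=.
transitivity (if (i + i' < k.+1)%N then H (i + i')%N i i' else 0).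
  case: ifPn => [lM|lM].
    rewrite (bigD1 (Ordinal lM)) //= eqxx big1 ?addr0// => l.
    by rewrite eq_sym -val_eqE /= => /negbTE ->.
  by rewrite big1// => l _; rewrite ifF//; apply/negbTE; have := ltn_ord l; lia.
case: ifPn => [lM|lM].
  rewrite /H (@sum_antidiag _ _ k.+1) ?ltnS ?leq_subr//.
  apply: eq_bigr => j _; apply: eq_bigr => j' _; congr (if _ then _ else _).
  by apply/eqP/eqP; lia.
by rewrite big1// => j _; rewrite big1// => j' _; rewrite ifF//; apply/negbTE; lia.
Qed.

(** Both sides run over all quadruples with sum k, the two middle indices being exchanged. This
    regroups the components of two products a b in a tensor into those of a and those of b. *)
Lemma sum_quad_swap (F : nat -> nat -> nat -> nat -> G) k :
  \sum_(l < k.+1) \sum_(i < l.+1) \sum_(j < (k - l).+1) F i (l - i)%N j (k - l - j)%N =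
  \sum_(l < k.+1) \sum_(i < l.+1) \sum_(j < (k - l).+1) F i j (l - i)%N (k - l - j)%N.
Proof.
rewrite sum_quad (sum_quad (fun i i' j j' => F i j i' j')).
apply: eq_bigr => i _; rewrite exchange_big; apply: eq_bigr => j _.
apply: eq_bigr => i' _; apply: eq_bigr => j' _ /=.
by rewrite -!addnA [(i' + _)%N]addnCA.
Qed.

End IndexSums.

Section FormsOnLists.
Context {R : realType} {V : completeNormedModType R} {T : tensor_powers V}.
Context {U : completeNormedModType R}.
Implicit Types phi : eform T U.

Definition clin_form phi := forall k, clinear (phi k).

Definition flist phi (l : seq V) : U := phi (size l) (tlist T l).

Definition fpre n (z : T n) phi : eform T U := fun k y => phi (n + k)%N (tmul z y).

Definition fpost (l : seq V) phi : eform T U :=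
  fun k z => phi (k + size l)%N (tmul z (tlist T l)).

Lemma eform_tpure phi k (v : k.-tuple V) : phi k (tpure T v) = flist phi v.
Proof.
case: v => l e; have ek : size l = k by apply/eqP.
by case: _ / ek e => e; congr (phi _ (tpure _ _)); exact: val_inj.
Qed.

Lemma eform_tmul_tlist phi (l l' : seq V) :
  phi (size l + size l')%N (tmul (tlist T l) (tlist T l')) = flist phi (l ++ l').
Proof. by rewrite tmul_tpure eform_tpure. Qed.

Lemma clin_fpre n (z : T n) phi : clin_form phi -> clin_form (fpre z phi).
Proof. by move=> cphi k; apply: clinear_comp (cphi _) (clinear_tmul _ _). Qed.

Lemma clin_fpost l phi : clin_form phi -> clin_form (fpost l phi).
Proof. by move=> cphi k; apply: clinear_comp (cphi _) (clinear_tmull _ _). Qed.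

Lemma fpre1 phi k (y : T k) : fpre (tpure T [tuple]) phi y = phi k y.
Proof.
rewrite /fpre; have := tproj_tmul1l k y.
by rewrite tproj_id (tproj_eq (erefl k)) /= => ->.
Qed.

Lemma eform_tsmul phi (a b : tseries T) k : clin_form phi ->
  phi k (tsmul a b k) = \sum_(i < k.+1) fpre (a i) phi (b (k - i)%N).
Proof.
move=> cphi; have [lphi _] := cphi k.
by rewrite /tsmul (lin_sum lphi); apply: eq_bigr => i _; rewrite eform_tcastp.
Qed.

End FormsOnLists.

(** * Tensor maps and the shuffle product of forms *)

Section TensorMaps.
Context {R : realType} {V : completeNormedModType R} {T : tensor_powers V}.
Context {U1 U2 : completeNormedModType R} {W : tensor_product U1 U2}.
Hypothesis hW : tensor_maps_bounded T W.
Implicit Types (half : bool) (phi : eform T U1) (psi : eform T U2).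

Lemma tensor_mapP m n (f : T m -> U1) (g : T n -> U2) : clinear f -> clinear g ->
  is_tensor_map f g (tensor_map W f g).
Proof.
by move=> cf cg; have [h hP _] := hW cf cg; apply: getPex; exists h.
Qed.

Lemma tuple_split (A : Type) m n (w : (m + n).-tuple A) :
  exists (u : m.-tuple A) (v : n.-tuple A),
    [/\ take m w = u, drop m w = v & w = [tuple of u ++ v]].
Proof.
have su : size (take m w) == m by rewrite size_takel// size_tuple leq_addr.
have sv : size (drop m w) == n by rewrite size_drop size_tuple addKn.
exists (Tuple su), (Tuple sv); split=> //; apply: val_inj => /=.
by rewrite cat_take_drop.
Qed.

(** [tensor_maps_bounded] bounds some tensor map, while [tensor_map] is chosen by [get]; agreement
    on pure tensors identifies the two. *)
Lemma is_tensor_map_uniq m n (f : T m -> U1) (g : T n -> U2) (h h' : T (m + n) -> W) :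
  is_tensor_map f g h -> is_tensor_map f g h' -> h =1 h'.
Proof.
move=> [ch hP] [ch' hP']; apply: clinear_tpure_eq => // w.
have [u [v [_ _ ->]]] := tuple_split w.
by rewrite -tmul_tpure hP hP'.
Qed.

Lemma lbound_tensor_map m n (f : T m -> U1) (g : T n -> U2) c d :
  clinear f -> clinear g -> 0 <= c -> 0 <= d -> lbound f c -> lbound g d ->
  lbound (tensor_map W f g) (c * d).
Proof.
move=> cf cg c0 d0 bf bg; have [h hP hfg] := hW cf cg.
move=> x; rewrite (is_tensor_map_uniq (tensor_mapP cf cg) hP).
apply: lbound_opnorm; first by case: hP => -[].
rewrite (le_trans hfg)// EFinM.
by apply: lee_pmul; [exact: opnorm_ge0|exact: opnorm_ge0|exact: opnorm_le|exact: opnorm_le].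
Qed.

Lemma tensor_map_tpure phi psi m n (w : (m + n).-tuple V) :
  clin_form phi -> clin_form psi ->
  tensor_map W (phi m) (psi n) (tpure T w) =
  tens W (flist phi (take m w)) (flist psi (drop m w)).
Proof.
move=> c1 c2; have [u [v [-> -> ->]]] := tuple_split w.
have [_ hP] := tensor_mapP (c1 m) (c2 n).
by rewrite -tmul_tpure hP !eform_tpure.
Qed.

Definition shuf (half : bool) n m (y : T (n + m)) : T (n + m) :=
  \sum_(tau in if half then Shlast n m else Sh n m) tact tau^-1%g y.

Lemma linear_shuf half n m : linear (@shuf half n m).
Proof. by apply: linear_sum_fun => tau _; exact: tact_linear. Qed.

(** Permutations act isometrically. Counting all of them, and not only the shuffles, gives a factor
    that depends on n + m alone. *)
Lemma lbound_shuf half n m : lbound (@shuf half n m) ((n + m)`!)%:R.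
Proof.
move=> y; rewrite /shuf (le_trans (ler_norm_sum _ _ _))//.
rewrite (eq_bigr (fun=> `|y|)); last by move=> tau _; rewrite norm_tact.
rewrite sumr_const -[_ *+ _]mulr_natl ler_wpM2r// ler_nat.
by rewrite (leq_trans (max_card _))// card_Sn.
Qed.

Lemma clinear_shuf half n m : clinear (@shuf half n m).
Proof. exact: lbound_clinear (@linear_shuf _ _ _) (@lbound_shuf _ _ _). Qed.

(* For half-shuffles the term [j = k] is excluded: [Shlast k 0] is not empty. *)
Definition shprod (half : bool) phi psi : eform T W := fun k y =>
  \sum_(j < k.+1 | half ==> (j < k)%N)
    tensor_map W (phi j) (psi (k - j)%N)
      (shuf half (tcastp (esym (subnKC (leq_ord j))) y)).

Arguments shprod half phi psi k y : clear implicits.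

Lemma clin_shprod half phi psi :
  clin_form phi -> clin_form psi -> clin_form (shprod half phi psi).
Proof.
move=> c1 c2 k; apply: clinear_sum => j _.
apply: clinear_comp; first by case: (tensor_mapP (c1 j) (c2 (k - j)%N)).
by apply: clinear_comp (clinear_shuf _ _ _) (clinear_tcastp _).
Qed.

(** In a half-shuffle the second factor never has degree 0, hence the restricted hypothesis on
    [psi]. It is essential for the defect of beta2, which has no small bound in degree 0. *)
Lemma lbound_shprod half phi psi (c d : nat -> R) k :
  clin_form phi -> clin_form psi ->
  (forall j, 0 <= c j) -> (forall j, 0 <= d j) ->
  (forall j, (j <= k)%N -> lbound (phi j) (c j)) ->
  (forall j, (0 < j <= k)%N || ~~ half && (j == 0%N) -> lbound (psi j) (d j)) ->
  lbound (shprod half phi psi k)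
    (\sum_(j < k.+1 | half ==> (j < k)%N) (c j * d (k - j)%N) * (k`!)%:R).
Proof.
move=> c1 c2 c0 d0 b1 b2; apply: lbound_sum => j jk.
apply: (lbound_comp (g := fun y => shuf half (tcastp (esym (subnKC (leq_ord j))) y))).
- exact: mulr_ge0.
- apply: lbound_tensor_map => //; first by apply: b1; have := ltn_ord j; lia.
  by apply: b2; case: half jk => /=; have := ltn_ord j; lia.
move=> y; rewrite (le_trans (lbound_shuf _ _))// norm_tcastp.
by rewrite subnKC// leq_ord.
Qed.

(** Shuffles act through their masks, so the sums over j and over shuffles merge into one sum over
    masks, j being the number of selected letters. The default [true] of [last] makes the
    half-shuffle sum over the empty list vanish, in agreement with the empty range [j < 0]. *)
Lemma shprod_tlist half phi psi (l : seq V) : clin_form phi -> clin_form psi ->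
  flist (shprod half phi psi) l =
  \sum_(mu <- masks (size l) | half ==> ~~ last true mu)
    tens W (flist phi (mask mu l)) (flist psi (mask (map negb mu) l)).
Proof.
move=> c1 c2; rewrite /flist /shprod; set k := size l.
pose G mu := tens W (flist phi (mask mu l)) (flist psi (mask (map negb mu) l)).
transitivity (\sum_(j < k.+1 | half ==> (j < k)%N)
    \sum_(mu <- masks k | (count id mu == j) && (half ==> ~~ last true mu)) G mu).
  apply: eq_bigr => j jk.
  have m0 : half -> (0 < k - j)%N by move=> h; rewrite subn_gt0; rewrite h in jk.
  rewrite -[in masks k](subnKC (leq_ord j)) -(@sum_shuffles j (k - j) _ half G m0).
  rewrite tcastp_tpure; set w := tcast _ _.
  have wl : w = l :> seq V by rewrite /w val_tcast.
  rewrite /shuf (lin_sum (tensor_mapP (c1 j) (c2 (k - j)%N)).1.1).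
  apply: eq_bigr => tau tauS; rewrite tact_tpure tensor_map_tpure//= /G.
  have tS : tau \in Sh j (k - j).
    by move: tauS; case: half {jk m0} => //; rewrite inE => /andP[].
  rewrite /= (Sh_act w tS) wl.
  have sm : size (mask (shmask tau) l) = j.
    by rewrite size_mask ?count_shmask// size_shmask subnKC// leq_ord.
  by rewrite take_size_cat// drop_size_cat.
rewrite (exchange_big_dep (fun mu => half ==> ~~ last true mu))/=; last first.
  by move=> j mu _ /andP[].
rewrite big_seq_cond [RHS]big_seq_cond; apply: eq_bigr => mu /andP[].
rewrite mem_masks => /eqP smu lmu.
have cj : (count id mu < k.+1)%N by rewrite ltnS -smu count_size.
rewrite (big_pred1 (Ordinal cj))// => j /=.
rewrite lmu andbT -val_eqE /= [count id mu == _]eq_sym.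
case: eqP => [jE|]; last by rewrite andbF.
rewrite andbT jE; case: half lmu => //= lmu.
(* A mask that selects every letter ends in [true], so the condition on the last letter already
   excludes j = k. *)
rewrite ltn_neqAle -{2}smu count_size andbT; apply: contra lmu => /eqP ck.
have : all id mu by rewrite all_count ck smu.
by case/lastP: mu {smu cj jE ck} => // mu b; rewrite last_rcons all_rcons => /andP[].
Qed.

Section Multilinearity.
Context (half : bool) (n : nat).

Lemma shprod_suml (f : 'I_n -> eform T U1) psi k (y : T k) :
  (forall i, clin_form (f i)) -> clin_form psi ->
  shprod half (fun k y => \sum_(i < n) f i k y) psi k y =
  \sum_(i < n) shprod half (f i) psi k y.
Proof.
move=> c1 c2; have cs : clin_form (fun k y => \sum_(i < n) f i k y).
  by move=> j; apply: clinear_sum => i _; exact: c1.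
move: y; apply: (@clinear_tlist_eq _ _ _ _ _
  (fun k y => \sum_(i < n) shprod half (f i) psi k y)).
- exact: clin_shprod.
- by apply: clinear_sum => i _; exact: clin_shprod.
move=> l _; rewrite -[LHS]/(flist (shprod half _ psi) l) shprod_tlist//.
under [RHS]eq_bigr => i _ do
  rewrite -[shprod _ _ _ _ _]/(flist (shprod half (f i) psi) l) shprod_tlist//.
rewrite [RHS]exchange_big; apply: eq_bigr => mu _.
exact: (lin_sum ((tens_bilin W).2 _)).
Qed.

Lemma shprod_sumr phi (f : 'I_n -> eform T U2) k (y : T k) :
  clin_form phi -> (forall i, clin_form (f i)) ->
  shprod half phi (fun k y => \sum_(i < n) f i k y) k y =
  \sum_(i < n) shprod half phi (f i) k y.
Proof.
move=> c1 c2; have cs : clin_form (fun k y => \sum_(i < n) f i k y).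
  by move=> j; apply: clinear_sum => i _; exact: c2.
move: y; apply: (@clinear_tlist_eq _ _ _ _ _
  (fun k y => \sum_(i < n) shprod half phi (f i) k y)).
- exact: clin_shprod.
- by apply: clinear_sum => i _; exact: clin_shprod.
move=> l _; rewrite -[LHS]/(flist (shprod half phi _) l) shprod_tlist//.
under [RHS]eq_bigr => i _ do
  rewrite -[shprod _ _ _ _ _]/(flist (shprod half phi (f i)) l) shprod_tlist//.
rewrite [RHS]exchange_big; apply: eq_bigr => mu _.
exact: (lin_sum ((tens_bilin W).1 _)).
Qed.

Definition fsub {U : completeNormedModType R} (f g : eform T U) : eform T U :=
  fun k y => f k y - g k y.

Lemma clin_fsub {U : completeNormedModType R} (f g : eform T U) :
  clin_form f -> clin_form g -> clin_form (fsub f g).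
Proof. by move=> cf cg k; exact: clinear_sub. Qed.

Lemma shprod_subl (f g : eform T U1) psi k (y : T k) :
  clin_form f -> clin_form g -> clin_form psi ->
  shprod half (fsub f g) psi k y = shprod half f psi k y - shprod half g psi k y.
Proof.
move=> cf cg c2; move: y; apply: (@clinear_tlist_eq _ _ _ _ _
  (fsub (shprod half f psi) (shprod half g psi))).
- exact/clin_shprod/c2/clin_fsub.
- by apply: clin_fsub; exact: clin_shprod.
move=> l _; rewrite -[LHS]/(flist (shprod half _ psi) l) shprod_tlist//; last exact: clin_fsub.
rewrite -[RHS]/(flist (shprod half _ _) l - flist (shprod half _ _) l) !shprod_tlist//.
rewrite -sumrB; apply: eq_bigr => mu _.
exact: (linB ((tens_bilin W).2 _)).
Qed.

Lemma shprod_subr phi (f g : eform T U2) k (y : T k) :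
  clin_form phi -> clin_form f -> clin_form g ->
  shprod half phi (fsub f g) k y = shprod half phi f k y - shprod half phi g k y.
Proof.
move=> c1 cf cg; move: y; apply: (@clinear_tlist_eq _ _ _ _ _
  (fsub (shprod half phi f) (shprod half phi g))).
- exact/clin_shprod/clin_fsub.
- by apply: clin_fsub; exact: clin_shprod.
move=> l _; rewrite -[LHS]/(flist (shprod half phi _) l) shprod_tlist//; last exact: clin_fsub.
rewrite -[RHS]/(flist (shprod half _ _) l - flist (shprod half _ _) l) !shprod_tlist//.
rewrite -sumrB; apply: eq_bigr => mu _.
exact: (linB ((tens_bilin W).1 _)).
Qed.

End Multilinearity.

(** Whether a shuffle is a half-shuffle depends on its last letter only, which lies in [l]; on the
    first a letters every mask is allowed, hence the full shuffle product there. *)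
Lemma shprod_cat half phi psi a (z : T a) (l : seq V) :
  clin_form phi -> clin_form psi -> (half -> (0 < size l)%N) ->
  shprod half phi psi (a + size l)%N (tmul z (tlist T l)) =
  \sum_(mu <- masks (size l) | half ==> ~~ last true mu)
    shprod false (fpost (mask mu l) phi) (fpost (mask (map negb mu) l) psi) a z.
Proof.
move=> c1 c2 l0; move: z; apply: (@clinear_tlist_eq _ _ _ _
  (fpost l (shprod half phi psi)) (fun a z =>
  \sum_(mu <- masks (size l) | half ==> ~~ last true mu)
    shprod false (fpost (mask mu l) phi) (fpost (mask (map negb mu) l) psi) a z)).
- exact/clin_fpost/clin_shprod.
- by apply: clinear_sum => mu _; apply: clin_shprod; exact: clin_fpost.
move=> u _; rewrite /fpost eform_tmul_tlist shprod_tlist// size_cat.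
under [RHS]eq_bigr => mu _ do
  rewrite -[shprod _ _ _ _ _]/(flist (shprod _ _ _) u)
          (shprod_tlist _ _ (clin_fpost _ c1) (clin_fpost _ c2)) /=.
rewrite big_mkcond /= big_masks_cat [RHS]exchange_big /=.
rewrite big_seq [RHS]big_seq; apply: eq_bigr => mu; rewrite mem_masks => /eqP smu.
rewrite [RHS]big_mkcond big_seq [RHS]big_seq; apply: eq_bigr => nu.
rewrite mem_masks => /eqP snu; rewrite last_cat mask_cat// map_cat mask_cat ?size_map//.
rewrite !/(flist (fpost _ _) _) /fpost !eform_tmul_tlist.
case: half l0 => //= /(_ isT); by case: nu snu => //= <-.
Qed.

End TensorMaps.
Arguments shprod {R V T U1 U2} W half phi psi k y : rename.

(** * Group-like series and the Leibniz rule *)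

Section GroupLike.
Context {R : realType} {V : completeNormedModType R} {T : tensor_powers V}.
Context {U1 U2 : completeNormedModType R} {W : tensor_product U1 U2}.
Hypothesis hW : tensor_maps_bounded T W.

(* The shuffle relations tested against [W]-valued tensor maps only: unlike
   [grouplike], this passes to quotients without tensor maps valued in [T]. *)
Definition weakly_grouplike (b : tseries T) :=
  b 0%N = tpure T [tuple] /\
  forall (phi : eform T U1) (psi : eform T U2) k,
    clin_form phi -> clin_form psi ->
    shprod W false phi psi k (b k) =
    \sum_(i < k.+1) tens W (phi i (b i)) (psi (k - i)%N (b (k - i)%N)).

Lemma grouplike_weakly b : grouplike b -> weakly_grouplike b.
Proof.
move=> [b0 bb]; split=> // phi psi k cphi cpsi; rewrite /shprod.
apply: eq_bigr => j _; rewrite tcastp_tseries /shuf -bb.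
by rewrite (tensor_mapP hW (cphi j) (cpsi (k - j)%N)).2.
Qed.

(** By [shprod_cat] each term is a full shuffle product evaluated at [b a], which the group-like
    relation splits into a sum of tensors. *)
Lemma shprod_tmul (half : bool) b (phi : eform T U1) (psi : eform T U2) a k (y : T k) :
  weakly_grouplike b -> clin_form phi -> clin_form psi -> (half -> (0 < k)%N) ->
  shprod W half phi psi (a + k)%N (tmul (b a) y) =
  \sum_(i < a.+1) shprod W half (fpre (b i) phi) (fpre (b (a - i)%N) psi) k y.
Proof.
move=> [b0 bb] cphi cpsi k0; move: y; apply: (@clinear_tlist_eq _ _ _ _
  (fpre (b a) (shprod W half phi psi)) (fun k y =>
  \sum_(i < a.+1) shprod W half (fpre (b i) phi) (fpre (b (a - i)%N) psi) k y)).
- exact/clin_fpre/clin_shprod.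
- by apply: clinear_sum => i _; apply: clin_shprod => //; exact: clin_fpre.
move=> l lk; rewrite /fpre shprod_cat//; last by rewrite lk.
under [RHS]eq_bigr => i _ do
  rewrite -[shprod _ _ _ _ _ _]/(flist (shprod W half (fpre (b i) phi)
    (fpre (b (a - i)%N) psi)) l) (shprod_tlist hW _ _ (clin_fpre _ cphi) (clin_fpre _ cpsi)).
rewrite [RHS]exchange_big /=; apply: eq_bigr => mu _.
by rewrite bb//; exact: clin_fpost.
Qed.

(** The shuffle product of phi and psi at a b is expanded in two ways, by the relation for a b and
    by the Leibniz rule for a. The terms with l >= 1 letters taken from a agree by induction on the
    degree, applied to the forms [fpre (a i) phi] and [fpre (a (l - i)) psi]; the remaining terms, l
    = 0, are the relation for b. With a = X_s this handles X_{s,t} without a study of inverses of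
    group-like series. *)
Lemma weakly_grouplike_quotient (a b : tseries T) :
  weakly_grouplike a -> b 0%N = tpure T [tuple] ->
  weakly_grouplike (tsmul a b) -> weakly_grouplike b.
Proof.
move=> ga b0 [_ gc]; split=> // phi psi k; elim/ltn_ind: k phi psi => k IH phi psi cphi cpsi.
pose F (i i' j j' : nat) := tens W (fpre (a i) phi (b i')) (fpre (a j) psi (b j')).
pose Z l := \sum_(i < l.+1)
  shprod W false (fpre (a i) phi) (fpre (a (l - i)%N) psi) (k - l)%N (b (k - l)%N).
pose Z' l := \sum_(i < l.+1) \sum_(j < (k - l).+1) F i j (l - i)%N (k - l - j)%N.
have ZZ : \sum_(l < k.+1) Z l = \sum_(l < k.+1) Z' l.
  transitivity (shprod W false phi psi k (tsmul a b k)).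
    rewrite (eform_tsmul _ _ _ (clin_shprod hW false cphi cpsi)).
    by apply: eq_bigr => l _; rewrite /fpre shprod_tmul.
  rewrite gc// /Z' -(sum_quad_swap F); apply: eq_bigr => l _.
  rewrite !eform_tsmul// (lin_sum ((tens_bilin W).2 _)); apply: eq_bigr => i _.
  by rewrite (lin_sum ((tens_bilin W).1 _)).
have ZE l : (0 < l <= k)%N -> Z l = Z' l.
  move=> /andP[l0 lk]; apply: eq_bigr => i _; rewrite IH//; [lia|exact: clin_fpre|exact: clin_fpre].
move: ZZ; rewrite big_ord_recl [RHS]big_ord_recl.
rewrite (eq_bigr (fun i : 'I_k => Z' (lift ord0 i))); last first.
  by move=> i _; rewrite ZE//= lift0; have := ltn_ord i; lia.
move=> /addIr; rewrite /Z /Z' !big_ord1 /= !subn0 (proj1 ga) => ZZ.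
transitivity (shprod W false (fpre (tpure T [tuple]) phi) (fpre (tpure T [tuple]) psi) k (b k)).
  have fpre1' (U : completeNormedModType R) (f : eform T U) :
      fpre (tpure T [tuple]) f = f.
    by apply: functional_extensionality_dep => n; apply: funext => y; rewrite fpre1.
  by rewrite !fpre1'.
rewrite ZZ; apply: eq_bigr => j _; rewrite /F (proj1 ga).
by rewrite !fpre1.
Qed.

End GroupLike.

(** * Sewing *)

Lemma powR_mono (R : realType) (r x y : R) :
  0 <= r -> 0 <= x -> x <= y -> x `^ r <= y `^ r.
Proof.
by move=> r0 x0 xy; apply: ge0_ler_powR; rewrite ?nnegrE// (le_trans x0).
Qed.

Section Partitions.
Context {R : realType}.
Implicit Types (a b s t u v : R) (D : seq R).

Lemma partition_sum_nil (G : nmodType) a (F : R -> R -> G) :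
  partition_sum a [::] F = 0.
Proof. by rewrite /partition_sum big_geq. Qed.

Lemma partition_sum_cons (G : nmodType) a x D (F : R -> R -> G) :
  partition_sum a (x :: D) F = F a x + partition_sum x D F.
Proof.
rewrite /partition_sum big_nat_recl //=; congr (_ + _).
apply: eq_big_nat => i /andP[_ iD].
by congr (F _ _); apply: set_nth_default => //; exact: ltnW.
Qed.

Lemma partition_sum_cat (G : nmodType) a D1 D2 (F : R -> R -> G) :
  partition_sum a (D1 ++ D2) F = partition_sum a D1 F + partition_sum (last a D1) D2 F.
Proof.
elim: D1 a => [|x D1 IH] a /=; first by rewrite partition_sum_nil add0r.
by rewrite !partition_sum_cons IH addrA.
Qed.

Lemma mesh_lt_cons a x D (e : R) : mesh_lt a (x :: D) e <-> x - a < e /\ mesh_lt x D e.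
Proof.
have E i : (i < size D)%N ->
    nth x (x :: D) i.+1 - nth x (x :: D) i = nth a (a :: x :: D) i.+2 - nth a (a :: x :: D) i.+1.
  by move=> iD; congr (_ - _); apply: set_nth_default => //; exact: ltnW.
split=> [m|[m0 m] [|i] //= iD].
  by split=> [|i iD]; [exact: (m 0%N)|rewrite E//; exact: m].
by have := m i iD; rewrite E.
Qed.

Lemma mesh_lt_cat a D1 D2 e :
  mesh_lt a D1 e -> mesh_lt (last a D1) D2 e -> mesh_lt a (D1 ++ D2) e.
Proof.
elim: D1 a => [//|x D1 IH] a /mesh_lt_cons[ax m1] m2.
by apply/mesh_lt_cons; split=> //; exact: IH.
Qed.

Lemma itv_partition_consP a b x D :
  itv_partition a b (x :: D) <-> a < x /\ itv_partition x b D.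
Proof.
by split=> [[/= /andP[ax xD] /eqP <-]|[ax [xD /eqP <-]]]; split=> //=; rewrite ?ax.
Qed.

Lemma itv_partition_catP a b D1 D2 :
  itv_partition a b (D1 ++ D2) <->
  itv_partition a (last a D1) D1 /\ itv_partition (last a D1) b D2.
Proof.
rewrite /itv_partition cat_path last_cat eqxx; split.
  by move=> [/andP[p1 p2] e].
by move=> [[p1 _] [p2 e]]; rewrite p1 p2.
Qed.

Lemma partition_mesh a b (d : R) : a <= b -> 0 < d ->
  exists2 D, itv_partition a b D & mesh_lt a D d.
Proof.
move=> ab d0; have [n] : exists n, b - a < (n%:R * (d / 2))%R.
  have d2 : 0 < d / 2 by rewrite divr_gt0.
  by exists (Num.truncn ((b - a) / (d / 2))).+1; rewrite -ltr_pdivrMr// truncnS_gt.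
elim: n a ab => [|n IH] a ab; first by rewrite mul0r; lra.
move=> ban; move: ab; rewrite le_eqVlt => /predU1P[<-|ab].
  by exists [::] => //; split=> //=.
have [bad|bad] := ltP (b - a) d.
  exists [:: b]; first exact: itv_partition1.
  by apply/mesh_lt_cons.
have [||D pD mD] := IH (a + d / 2); [lra| |].
  by move: ban; rewrite -natr1 mulrDl mul1r; lra.
exists (a + d / 2 :: D); first by apply/itv_partition_consP; split=> //; lra.
by apply/mesh_lt_cons; split=> //; lra.
Qed.

End Partitions.

Section Sewing.
Context {R : realType} {U : completeNormedModType R}.
Implicit Types (a b s t u v : R) (D : seq R).

(** The solution K of K = 2^(1 - theta) K + 2: two halves, each with a factor 2^(- theta), and two
    additivity errors. *)
Definition sewing_const (theta : R) : R := 2 / (1 - 2 `^ (1 - theta)).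

Lemma powR2_lt1 (x : R) : 0 < x -> 2 `^ (- x) < 1 :> R.
Proof.
move=> x0; rewrite powRN invf_lt1 ?powR_gt0//.
rewrite -[ltLHS](congr1 (fun f => f x) (@powR1 R)).
by apply: gt0_ltr_powR => //; rewrite ?nnegrE; lra.
Qed.

Lemma sewing_const_denom theta : 1 < theta -> 0 < 1 - 2 `^ (1 - theta) :> R.
Proof. by move=> th; rewrite subr_gt0 -opprB powR2_lt1// subr_gt0. Qed.

Lemma sewing_const_ge0 theta : 1 < theta -> 0 <= sewing_const theta.
Proof. by move=> th; rewrite divr_ge0// ltW// sewing_const_denom. Qed.

(** A control without continuity, since the p-variation is superadditive but merely dominated by a
    control. *)
Record superadditive (w : R -> R -> R) : Prop := {
  superadd_ge0 : forall s t, 0 <= s -> s <= t -> t <= 1 -> 0 <= w s t;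
  superadd_diag : forall t, 0 <= t -> t <= 1 -> w t t = 0;
  superaddD : forall s u t, 0 <= s -> s <= u -> u <= t -> t <= 1 ->
    w s u + w u t <= w s t }.

Lemma superadd_mono w s t s' t' : superadditive w ->
  0 <= s -> s <= s' -> s' <= t' -> t' <= t -> t <= 1 -> w s' t' <= w s t.
Proof.
move=> sw s0 ss st tt t1.
have h1 : w s s' + w s' t <= w s t by apply: (superaddD sw) => //; lra.
have h2 : w s' t' + w t' t <= w s' t by apply: (superaddD sw) => //; lra.
have h3 : 0 <= w s s' by apply: (superadd_ge0 sw) => //; lra.
have h4 : 0 <= w t' t by apply: (superadd_ge0 sw) => //; lra.
lra.
Qed.

Lemma control_superadditive w : control w -> superadditive w.
Proof. by case. Qed.

Context (w : R -> R -> R) (theta A : R) (Xi : R -> R -> U).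
Hypothesis sw : superadditive w.
Hypothesis theta1 : 1 < theta.
Hypothesis A0 : 0 <= A.
Hypothesis Xi0 : forall t, 0 <= t -> t <= 1 -> Xi t t = 0.
Hypothesis dXi : forall s u t, 0 <= s -> s < u -> u < t -> t <= 1 ->
  `|Xi s t - (Xi s u + Xi u t)| <= A * w s t `^ theta.

Let theta0 : 0 <= theta.
Proof. by rewrite ltW// (lt_trans _ theta1). Qed.

Let dXi' s u t : 0 <= s -> s <= u -> u <= t -> t <= 1 ->
  `|Xi s t - (Xi s u + Xi u t)| <= A * w s t `^ theta.
Proof.
move=> s0 su ut t1; have A' : 0 <= A * w s t `^ theta by rewrite mulr_ge0// powR_ge0.
have [su'|su'] := eqVneq s u.
  by rewrite -su' Xi0; [rewrite add0r subrr normr0|lra|lra].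
have [ut'|ut'] := eqVneq u t.
  by rewrite ut' Xi0; [rewrite addr0 subrr normr0|lra|lra].
by apply: dXi; rewrite // lt_neqAle ?su' ?ut'.
Qed.

Lemma partition_halving s t D : 0 <= s -> t <= 1 -> itv_partition s t D -> D != [::] ->
  exists D1 u D2, [/\ D = D1 ++ u :: D2, w s (last s D1) <= w s t / 2
    & w u t <= w s t / 2].
Proof.
move=> s0 t1 pD Dn.
have wst : 0 <= w s t.
  by apply: (superadd_ge0 sw) => //; exact: itv_partition_le pD.
(* The scan keeps a prefix [D1] carrying at most half of the control. It stops at the first point
   [u] past half, where superadditivity bounds the rest, or else at the end point t. *)
suff H D1 D2 : D = D1 ++ D2 -> D2 != [::] -> w s (last s D1) <= w s t / 2 ->
    exists D1 u D2, [/\ D = D1 ++ u :: D2, w s (last s D1) <= w s t / 2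
      & w u t <= w s t / 2].
  apply: (H [::] D) => //=; rewrite (superadd_diag sw) ?divr_ge0//.
  by rewrite (le_trans (itv_partition_le pD)).
elim: D2 D1 => [//|u D2 IH] D1 DE _ h1.
have [su ut] : s <= u /\ u <= t.
  move: pD; rewrite DE => /itv_partition_catP[/itv_partition_le sl].
  by move=> /itv_partition_consP[lu /itv_partition_le]; split=> //; lra.
have [h2|h2] := leP (w s u) (w s t / 2); last first.
  exists D1, u, D2; split=> //.
  by have := superaddD sw s0 su ut t1; lra.
have [D20|D20] := eqVneq D2 [::]; last first.
  by apply: (IH (rcons D1 u)) => //; rewrite ?cat_rcons ?last_rcons.
exists D1, u, D2; split=> //.
have -> : u = t.
  by case: pD => _; rewrite DE D20 cats1 last_rcons => /eqP.
rewrite (superadd_diag sw) ?divr_ge0//; lra.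
Qed.

Lemma sewing_bound s t D : 0 <= s -> t <= 1 -> itv_partition s t D ->
  `|partition_sum s D Xi - Xi s t| <= sewing_const theta * A * w s t `^ theta.
Proof.
have K0 := sewing_const_ge0 theta1.
have [n] := ubnP (size D); elim: n s t D => [//|n IH] s t D Dn s0 t1 pD.
have [D0|D0] := eqVneq D [::].
  have st : s = t by case: pD; rewrite D0 => _ /eqP.
  rewrite D0 partition_sum_nil st Xi0//; last by rewrite -st.
  by rewrite subrr normr0 mulr_ge0 ?powR_ge0// mulr_ge0.
have [D1 [u [D2 [DE h1 h2]]]] := partition_halving s0 t1 pD D0.
move: pD; rewrite DE => /itv_partition_catP[p1 /itv_partition_consP[vu p2]].
set v := last s D1 in h1 p1 vu *.
have sv := itv_partition_le p1; have ut := itv_partition_le p2.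
have b1 : `|partition_sum s D1 Xi - Xi s v| <= sewing_const theta * A * w s v `^ theta.
  by apply: IH => //; [move: Dn; rewrite DE size_cat /=; lia|lra].
have b2 : `|partition_sum u D2 Xi - Xi u t| <= sewing_const theta * A * w u t `^ theta.
  by apply: IH => //; [move: Dn; rewrite DE size_cat /=; lia|lra].
(* The interval [v, u] may carry most of the control. Its value is kept exactly, at the price of two
   additivity errors, over [s, u] and over [s, t]. *)
have b3 : `|Xi s u - (Xi s v + Xi v u)| <= A * w s t `^ theta.
  apply: le_trans (dXi' s0 sv (ltW vu) _) _; first lra.
  apply: ler_wpM2l => //; apply: powR_mono => //.
  - by apply: (superadd_ge0 sw); lra.
  - by apply: (superadd_mono sw); lra.
have b4 : `|Xi s t - (Xi s u + Xi u t)| <= A * w s t `^ theta by apply: dXi'; lra.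
have su : s <= u by lra.
have st : s <= t by lra.
have wst : 0 <= w s t by apply: (superadd_ge0 sw); lra.
have halfp x : 0 <= x -> x <= w s t / 2 -> x `^ theta <= 2 `^ (- theta) * w s t `^ theta.
  move=> x0 xw; apply: le_trans (powR_mono theta0 x0 xw) _.
  by rewrite powRM ?invr_ge0// mulrC -[2^-1]powR_inv1// -powRrM mulN1r.
have c1 : w s v `^ theta <= 2 `^ (- theta) * w s t `^ theta.
  by apply: halfp => //; apply: (superadd_ge0 sw); lra.
have c2 : w u t `^ theta <= 2 `^ (- theta) * w s t `^ theta.
  by apply: halfp => //; apply: (superadd_ge0 sw); lra.
rewrite partition_sum_cat partition_sum_cons -/v.
set S1 := partition_sum s D1 Xi in b1 *; set S2 := partition_sum u D2 Xi in b2 *.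
have telescope (a b c d x y z : U) :
    a + (b + c) - d = (a - x) + (c - y) + ((x + b - z) + (z + y - d)).
  have -> : z + y - d = z + (y - d) by rewrite addrA.
  by rewrite subrKA addrACA !subrKA !addrA.
rewrite (telescope _ _ _ _ (Xi s v) (Xi u t) (Xi s u)).
rewrite (le_trans (ler_normD _ _))// (le_trans (lerD (ler_normD _ _) (ler_normD _ _)))//.
rewrite [`|Xi s v + _ - _|]distrC [`|Xi s u + _ - _|]distrC.
apply: le_trans (lerD (lerD b1 b2) (lerD b3 b4)) _.
set K := sewing_const theta in K0 *; set W := w s t `^ theta in c1 c2 *.
have KA : K * 2 `^ (1 - theta) + 2 = K.
  have d0 := sewing_const_denom theta1.
  by rewrite /K /sewing_const; field; rewrite gt_eqF.
have p2E : 2 `^ (1 - theta) = 2 * 2 `^ (- theta) :> R.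
  by rewrite powRD ?powRr1//; apply/implyP => _.
have KA0 : 0 <= K * A by rewrite mulr_ge0.
have := ler_wpM2l KA0 c1; have := ler_wpM2l KA0 c2.
have -> : K * A * W = K * A * (2 `^ (- theta) * W) * 2 + 2 * (A * W).
  by rewrite -{1}KA p2E; ring.
by set a := _ * w s v `^ _; set b := _ * w u t `^ _; lra.
Qed.

End Sewing.

(** Continuity at the points of the diagonal is made uniform by compactness of [0, 1]. *)
Lemma control_small {R : realType} (w : R -> R -> R) : control w ->
  forall e : R, 0 < e -> exists2 d : R, 0 < d &
    forall s t : R, 0 <= s -> s <= t -> t <= 1 -> t - s < d -> w s t < e.
Proof.
move=> cw e e0; have [_ wd _ wc] := cw.
have : near_covering (`[0, 1]%classic : set R).
  by apply/compact_near_coveringP; exact: segment_compact.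
move=> /(_ R 0^'+ (fun d s => 0 <= s -> forall t, s <= t -> t <= 1 -> t - s < d -> w s t < e)).
case=> [x|d /= d0 dP].
  rewrite /= in_itv /= => /andP[x0 x1].
  have /subspace_continuousP/(_ (x, x)) /= := wc.
  move=> /(_ (And3 x0 (lexx x) x1))/cvgrPdist_lt/(_ e e0).
  rewrite nearE /within => /nbhs_ballP[r /= r0 rP].
  (* Half of the radius for the distance from x to s and half for t - s, so that t too is within r
     of x. *)
  exists (ball x (r / 2), [set d | 0 < d < r / 2]) => /=.
    split; first by apply: nbhsx_ballx; rewrite divr_gt0.
    have r2 : 0 < r / 2 by rewrite divr_gt0.
    by apply: filterS2 (nbhs_right_gt 0) (nbhs_right_lt r2) => d /= -> ->.
  move=> [s d] [/= + /andP[d0 dr]] s0 t st t1 tsd.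
  rewrite -ball_normE /ball_ /= => xs.
  have /rP : ball (x, x) r (s, t).
    split; rewrite /= -ball_normE /ball_ /=; first lra.
    by rewrite ltr_norml in xs; rewrite ltr_norml; lra.
  move=> /(_ (And3 s0 st t1)); rewrite /from_subspace /= wd// sub0r normrN ger0_norm//.
  exact: (control_ge0 cw).
have H := dP (d / 2); rewrite /ball_ /= sub0r normrN gtr0_norm ?divr_gt0// in H.
have {}H := H ltac:(lra) ltac:(lra).
exists (d / 2); first by rewrite divr_gt0.
move=> s t s0 st t1 tsd; apply: H => //; try lra.
by rewrite /= in_itv /= s0 (le_trans st).
Qed.

(** * Limits of Riemann sums *)

Section SewingLimit.
Context {R : realType} {U : completeNormedModType R}.
Implicit Types (a b s t u v : R) (D : seq R).

Lemma itv_partition_mem s t D y : itv_partition s t D -> y \in D -> s < y <= t.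
Proof.
move=> pD yD; case/splitPr: yD pD => D1 D2 /itv_partition_catP[/itv_partition_le sl].
by move=> /itv_partition_consP[ly /itv_partition_le ->]; rewrite (le_lt_trans sl).
Qed.

Lemma itv_partition_last s t D : itv_partition s t D -> D != [::] -> t \in D.
Proof.
by case: D => // x D [_ /eqP /= <-] _; rewrite mem_last.
Qed.

Lemma common_refinement s t D D' : itv_partition s t D -> itv_partition s t D' ->
  exists E, [/\ itv_partition s t E, {subset D <= E} & {subset D' <= E}].
Proof.
move=> pD pD'; have [D0|D0] := eqVneq D [::].
  by exists D'; split=> // y; rewrite D0.
pose E := sort <=%O (undup (D ++ D')).
have memE y : (y \in E) = (y \in D) || (y \in D').
  by rewrite mem_sort mem_undup mem_cat.
have bE y : y \in E -> s < y <= t.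
  by rewrite memE => /orP[/(itv_partition_mem pD)|/(itv_partition_mem pD')].
have pathE : path <%O s E.
  rewrite path_sortedE; last exact: lt_trans.
  rewrite sort_lt_sorted undup_uniq andbT; apply/allP => y /bE.
  by case/andP.
have tE : t \in E by rewrite memE (itv_partition_last pD).
exists E; split; [|by move=> y; rewrite memE => ->|by move=> y; rewrite memE orbC => ->].
split=> //; case/splitPr: tE bE pathE => E1 [|y E2] bE; first by rewrite last_cat.
rewrite cat_path /= => /and4P[_ _ ty _].
have /andP[_ yt] : s < y <= t by apply: bE; rewrite mem_cat !inE eqxx !orbT.
by have := lt_le_trans ty yt; rewrite ltxx.
Qed.

Context (w : R -> R -> R) (theta A : R) (Xi : R -> R -> U).
Hypothesis sw : superadditive w.
Hypothesis theta1 : 1 < theta.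
Hypothesis A0 : 0 <= A.
Hypothesis Xi0 : forall t, 0 <= t -> t <= 1 -> Xi t t = 0.
Hypothesis dXi : forall s u t, 0 <= s -> s < u -> u < t -> t <= 1 ->
  `|Xi s t - (Xi s u + Xi u t)| <= A * w s t `^ theta.

(** The sewing bound is applied on each interval of [D] to the part of [E] that subdivides it. *)
Lemma refinement_bound s t D E : 0 <= s -> t <= 1 -> itv_partition s t D ->
  itv_partition s t E -> {subset D <= E} ->
  `|partition_sum s E Xi - partition_sum s D Xi| <=
  sewing_const theta * A * partition_sum s D (fun u v => w u v `^ theta).
Proof.
elim: D s E => [|x D IH] s E s0 t1.
  move=> /itv_partition_nil <- /itv_partitionxx -> _.
  by rewrite !partition_sum_nil subrr normr0 mulr0.
move=> pD pE DE; have /itv_partition_consP[sx px] := pD.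
have xE : x \in E by apply: DE; rewrite mem_head.
case/splitPr: xE pE DE => E1 E2; rewrite -cat_rcons => /itv_partition_catP[].
rewrite last_rcons => pE1 pE2 DE.
have DE2 : {subset D <= E2}.
  move=> y yD; have /andP[xy _] := itv_partition_mem px yD.
  have : y \in rcons E1 x ++ E2 by apply: DE; rewrite inE yD orbT.
  rewrite mem_cat => /orP[/(itv_partition_mem pE1)/andP[_]|//].
  by rewrite leNgt xy.
have xt := itv_partition_le px.
have h1 : `|partition_sum x E2 Xi - partition_sum x D Xi| <=
  sewing_const theta * A * partition_sum x D (fun u v => w u v `^ theta).
  by apply: IH => //; exact: ltW (le_lt_trans s0 sx).
have h2 := sewing_bound sw theta1 A0 Xi0 dXi s0 (le_trans xt t1) pE1.
rewrite partition_sum_cat !partition_sum_cons last_rcons opprD addrACA mulrDr.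
by rewrite (le_trans (ler_normD _ _))// lerD.
Qed.

(** On a small interval w^theta = w^(theta - 1) w <= e^(theta - 1) w, and the remaining factors w
    add up by superadditivity. *)
Lemma partition_sum_powR s t D (e d : R) : 0 <= s -> t <= 1 ->
  (forall s t : R, 0 <= s -> s <= t -> t <= 1 -> t - s < d -> w s t < e) ->
  itv_partition s t D -> mesh_lt s D d ->
  partition_sum s D (fun u v => w u v `^ theta) <= e `^ (theta - 1) * w s t.
Proof.
move=> s0 t1 wd; elim: D s s0 => [|x D IH] s s0 pD.
  move=> _; rewrite partition_sum_nil mulr_ge0 ?powR_ge0//.
  by apply: (superadd_ge0 sw) => //; exact: itv_partition_le pD.
move=> /mesh_lt_cons[xsd mD]; have /itv_partition_consP[sx px] := pD.
have xt := itv_partition_le px.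
have ws0 : 0 <= w s x by apply: (superadd_ge0 sw) => //; lra.
have we : w s x < e by apply: wd; lra.
rewrite partition_sum_cons.
have h := superaddD sw s0 (ltW sx) xt t1.
apply: le_trans (_ : e `^ (theta - 1) * (w s x + w x t) <= _); last first.
  by rewrite ler_wpM2l// powR_ge0.
rewrite mulrDr lerD//; last by apply: IH => //; exact: ltW (le_lt_trans s0 sx).
rewrite -[leLHS]mulr_powRB1//; last exact: lt_trans ltr01 theta1.
by rewrite mulrC ler_wpM2r// powR_mono// ?subr_ge0 ltW.
Qed.

Definition is_sewing t (I : U) := forall e, 0 < e -> exists2 d, 0 < d &
  forall D, itv_partition 0 t D -> mesh_lt 0 D d -> `|partition_sum 0 D Xi - I| < e.

(** Fine partitions of [0, s] and [s, t] concatenate, so [It - Is] is approximated by sums over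
    [s, t], and [sewing_bound] holds whatever the mesh. Existence of the two limits is an assumption
    here, which allows [w] to contain the p-variation. *)
Lemma sewing_increment s t Is It : 0 <= s -> s <= t -> t <= 1 ->
  is_sewing s Is -> is_sewing t It ->
  `|It - Is - Xi s t| <= sewing_const theta * A * w s t `^ theta.
Proof.
move=> s0 st t1 sI tI; apply/ler_addgt0Pr => e e0.
have e2 : 0 < e / 2 by rewrite divr_gt0.
have [d1 d10 hs] := sI _ e2; have [d2 d20 ht] := tI _ e2.
have dd : 0 < Num.min d1 d2 by rewrite lt_min d10.
have [D1 pD1 mD1] := partition_mesh s0 dd.
have [D2 pD2 mD2] := partition_mesh st dd.
have lD1 : last 0 D1 = s by case: pD1 => _ /eqP.
have mesh_le a D d d' : d <= d' -> mesh_lt a D d -> mesh_lt a D d'.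
  by move=> dd' m i iD; rewrite (lt_le_trans (m i iD)).
have h1 : `|partition_sum 0 D1 Xi - Is| < e / 2.
  by apply: hs => //; apply: mesh_le mD1; rewrite ge_min lexx.
have h2 : `|partition_sum 0 (D1 ++ D2) Xi - It| < e / 2.
  apply: ht; first by apply/itv_partition_catP; rewrite lD1.
  apply: (@mesh_le _ _ (Num.min d1 d2)); first by rewrite ge_min lexx orbT.
  by apply: mesh_lt_cat; rewrite ?lD1.
have h3 := sewing_bound sw theta1 A0 Xi0 dXi s0 t1 pD2.
rewrite partition_sum_cat lD1 in h2.
set S1 := partition_sum 0 D1 Xi in h1 h2; set S2 := partition_sum s D2 Xi in h2 h3.
have -> : It - Is - Xi s t = (S2 - Xi s t) + (S1 - Is) - (S1 + S2 - It).
  rewrite [(S2 - _) + _]addrACA -opprD [S1 + S2]addrC opprB [RHS]addrC subrKA.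
  by rewrite opprD addrA addrAC.
rewrite (le_trans (ler_normB _ _))//.
have := ler_normD (S2 - Xi s t) (S1 - Is); lra.
Qed.

Hypothesis cw : control w.

Lemma sewing_exists t : 0 <= t -> t <= 1 -> exists I, is_sewing t I.
Proof.
move=> t0 t1; pose B d := [set D | itv_partition 0 t D /\ mesh_lt 0 D d].
have FB : Filter (filter_from [set d : R | 0 < d] B).
  apply: filter_from_filter; first by exists 1; exact: ltr01.
  move=> i j /= i0 j0; exists (Num.min i j); first by rewrite /= lt_min i0.
  by move=> D [pD mD]; split; (split; [exact: pD|]) => k kD; have := mD k kD;
    rewrite lt_min => /andP[].
have PB : ProperFilter (filter_from [set d : R | 0 < d] B).
  apply: filter_from_proper => d /= d0.
  by have [D pD mD] := partition_mesh t0 d0; exists D.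
pose G := (fun D => partition_sum 0 D Xi) @ filter_from [set d : R | 0 < d] B.
have K0 := sewing_const_ge0 theta1.
have cauchyG : cauchy G.
  apply: cauchy_exP => e e0.
  (* Each of two sums differs from the one over a common refinement by at most half of (M - 1) * (e
     / M), which is less than e in total; the summand 1 keeps M positive. *)
  pose M := 2 * (sewing_const theta * A * w 0 t) + 1.
  have w0t : 0 <= w 0 t by apply: (superadd_ge0 sw).
  have KAw : 0 <= sewing_const theta * A * w 0 t by rewrite mulr_ge0// mulr_ge0.
  have M0 : 0 < M by rewrite /M; lra.
  (* Solves r^(theta - 1) = e / M, the factor gained in [partition_sum_powR] when w is below r on
     each interval. *)
  pose r := (e / M) `^ (theta - 1)^-1.
  have r0 : 0 < r by rewrite powR_gt0// divr_gt0.
  have rE : r `^ (theta - 1) = e / M.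
    by rewrite -powRrM mulVf ?powRr1 ?divr_ge0 ?(ltW M0) ?(ltW e0)// gt_eqF// subr_gt0.
  have [d d0 dP] := control_small cw r0.
  have [D0 pD0 mD0] := partition_mesh t0 d0.
  exists (partition_sum 0 D0 Xi); exists d => //= D [pD mD].
  have [E [pE D0E DE]] := common_refinement pD0 pD.
  rewrite /= -ball_normE /ball_ /=.
  have h0 := refinement_bound (lexx 0) t1 pD0 pE D0E.
  have h := refinement_bound (lexx 0) t1 pD pE DE.
  have g0 := partition_sum_powR (lexx 0) t1 dP pD0 mD0.
  have g := partition_sum_powR (lexx 0) t1 dP pD mD.
  rewrite -[_ - _](subrKA (partition_sum 0 E Xi)) (le_lt_trans (ler_normD _ _))//.
  rewrite distrC (le_lt_trans (lerD h0 h))//.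
  have KA0 : 0 <= sewing_const theta * A by rewrite mulr_ge0.
  apply: (le_lt_trans (lerD (ler_wpM2l KA0 g0) (ler_wpM2l KA0 g))).
  rewrite rE; have -> : sewing_const theta * A * (e / M * w 0 t) +
    sewing_const theta * A * (e / M * w 0 t) = (M - 1) * (e / M) by rewrite /M; ring.
  by rewrite mulrCA gtr_pMr// ltr_pdivrMr//; lra.
have := @cauchy_cvg _ G _ cauchyG.
set I := lim G => GI; exists I => e e0.
have /cvgrPdist_lt/(_ e e0)[d d0 dP] : (fun D => partition_sum 0 D Xi) @
  filter_from [set d : R | 0 < d] B --> I by exact: GI.
by exists d => // D pD mD; rewrite distrC; apply: dP.
Qed.

End SewingLimit.

(** * Rough paths and one-forms *)

Section PathIncrements.
Context {R : realType} {V : completeNormedModType R} {T : tensor_powers V}.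
Context (p : R) (X : R -> tseries T).
Hypothesis p1 : (1 <= p :> R).
Hypothesis HX : geometric_rough_path p X.

Let Xg t : 0 <= t -> t <= 1 -> grouplike (X t).
Proof. by move=> t0 t1; apply: HX.1; rewrite t0. Qed.

Let p0 : (0 < p :> R). Proof. exact: lt_le_trans ltr01 p1. Qed.

Lemma pincr_0 s t : 0 <= s <= 1 -> 0 <= t <= 1 -> pincr X s t 0%N = tpure T [tuple].
Proof.
move=> /andP[s0 s1] /andP[t0 t1].
have [_ _ is0] := tsinvP (Xg s0 s1).1.
by rewrite /pincr tsmul_0//; exact: (Xg t0 t1).1.
Qed.

Lemma tsmul_pincr s t : 0 <= s <= 1 -> tsmul (X s) (pincr X s t) = X t.
Proof.
move=> /andP[s0 s1]; have [_ si _] := tsinvP (Xg s0 s1).1.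
by rewrite /pincr -tsmulA si tsmul1s.
Qed.

Lemma pincr_chen s u t : 0 <= u <= 1 ->
  tsmul (pincr X s u) (pincr X u t) = pincr X s t.
Proof. by move=> u01; rewrite {1}/pincr tsmulA tsmul_pincr. Qed.

Lemma pincr_diag t : 0 <= t <= 1 -> pincr X t t = tsone.
Proof. by move=> /andP[t0 t1]; have [] := tsinvP (Xg t0 t1).1. Qed.

Lemma pincr_weakly_grouplike (U1 U2 : completeNormedModType R)
    (W : tensor_product U1 U2) s t : tensor_maps_bounded T W ->
  0 <= s <= 1 -> 0 <= t <= 1 -> weakly_grouplike (W := W) (pincr X s t).
Proof.
move=> hW s01 t01; apply: (@weakly_grouplike_quotient _ _ _ _ _ _ hW (X s)).
- by apply: grouplike_weakly => //; case/andP: s01; exact: Xg.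
- exact: pincr_0.
- by rewrite tsmul_pincr//; apply: grouplike_weakly => //; case/andP: t01; exact: Xg.
Qed.

Let F u v : \bar R := (gdist (X u) (X v) `^ p)%E.

Let partition_sum_ge0 a D : (0 <= partition_sum a D F)%E.
Proof. by apply: sume_ge0 => i _; exact: poweR_ge0. Qed.

Lemma pvar_ge0 s t : s <= t -> (0 <= pvar p X s t)%E.
Proof.
move=> st; have [D pD _] := partition_mesh st ltr01.
by apply: (le_trans (partition_sum_ge0 s D)); apply: ereal_sup_ubound; exists D.
Qed.

Lemma pvar_fin_num s t : 0 <= s -> s <= t -> t <= 1 -> pvar p X s t \is a fin_num.
Proof.
move=> s0 st t1; rewrite ge0_fin_numE ?pvar_ge0//.
have [_ [w _ hw]] := HX.
by rewrite (le_lt_trans (hw s t s0 st t1))// ltry.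
Qed.

Lemma superadditive_pvar : superadditive (fun s t => fine (pvar p X s t)).
Proof.
split=> [s t s0 st t1|t t0 t1|s u t s0 su ut t1].
- by rewrite fine_ge0// pvar_ge0.
- suff -> : pvar p X t t = 0%E by [].
  apply/eqP; rewrite eq_le pvar_ge0// andbT; apply: ge_ereal_sup.
  by move=> _ [D /itv_partitionxx -> <-]; rewrite partition_sum_nil.
have [st u1 u0] : [/\ s <= t, u <= 1 & 0 <= u] by split; lra.
have fsu := pvar_fin_num s0 su u1; have fut := pvar_fin_num u0 ut t1.
have fst := pvar_fin_num s0 st t1.
suff h : (pvar p X s u + pvar p X u t <= pvar p X s t)%E.
  move: h; rewrite -{1}(fineK fsu) -{1}(fineK fut) -{1}(fineK fst).
  by rewrite -EFinD lee_fin.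
have fD1 D1 : itv_partition s u D1 -> partition_sum s D1 F \is a fin_num.
  move=> pD1; rewrite (ge0_fin_numE (partition_sum_ge0 _ _)).
  apply: (@le_lt_trans _ _ (pvar p X s u)); last by rewrite ltey_eq fsu.
  by apply: ereal_sup_ubound; exists D1.
(* The suprema are treated one at a time, the other summand being finite and moved to the right;
   partitions of [s, u] and [u, t] then concatenate. *)
rewrite -(leeBrDr _ _ fut); apply: ge_ereal_sup => _ [D1 pD1 <-].
rewrite (leeBrDr _ _ fut) addeC -(leeBrDr _ _ (fD1 _ pD1)).
apply: ge_ereal_sup => _ [D2 pD2 <-].
rewrite (leeBrDr _ _ (fD1 _ pD1)) addeC.
have lD1 : last s D1 = u by case: pD1 => _ /eqP.
rewrite -[X in (_ + partition_sum X D2 _)%E]lD1 -partition_sum_cat.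
apply: ereal_sup_ubound; exists (D1 ++ D2) => //.
by apply/itv_partition_catP; rewrite lD1.
Qed.

(** The partition of [s, t] into one interval gives d(X_s, X_t)^p, which controls every positive
    degree. Degree 0 uses x^0 = 1, valid also at x = 0. *)
Lemma norm_pincr s t k : 0 <= s -> s < t -> t <= 1 ->
  `|pincr X s t k| <= fine (pvar p X s t) `^ (k%:R / p).
Proof.
move=> s0 st t1; case: k => [|k].
  by rewrite mul0r powRr0 pincr_0 ?norm_tpure0//; lra.
have fst := pvar_fin_num s0 (ltW st) t1.
set x := `|_|; have x0 : 0 <= x by exact: normr_ge0.
have h : (x `^ k.+1%:R^-1) `^ p <= fine (pvar p X s t).
  rewrite -lee_fin fineK// -poweR_EFin.
  have h1 : ((x `^ k.+1%:R^-1)%:E <= gdist (X s) (X t))%E.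
    by apply: ereal_sup_ubound; exists k.+1.
  apply: (@le_trans _ _ (F s t)).
    apply: gt0_ler_poweR => //; first exact: ltW.
    - by rewrite in_itv /= leey andbT lee_fin powR_ge0.
    - by rewrite in_itv /= leey andbT (le_trans _ h1)// lee_fin powR_ge0.
  apply: ereal_sup_ubound; exists [:: t]; first exact: itv_partition1.
  by rewrite partition_sum_cons partition_sum_nil adde0.
have kp : 0 <= k.+1%:R / p by rewrite divr_ge0// ltW.
have := powR_mono kp (powR_ge0 _ _) h.
suff -> : ((x `^ k.+1%:R^-1) `^ p) `^ (k.+1%:R / p) = x by [].
rewrite -!powRrM (_ : _ * _ = 1) ?powRr1//.
by field; rewrite nat1r pnatr_eq0 gt_eqF.
Qed.

End PathIncrements.

(** * The slow norm in terms of real bounds *)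

Section SlowNorm.
Context {R : realType} {V : completeNormedModType R} {T : tensor_powers V}.
Context {U : completeNormedModType R} (p : R) (X : R -> tseries T).
Context (beta : R -> eform T U) (w : R -> R -> R) (theta : R).
Let N := Num.truncn p.

Lemma bigmaxe_le n (f : nat -> \bar R) (M : \bar R) : (0 <= M)%E ->
  (forall k, (1 <= k <= n)%N -> (f k <= M)%E) ->
  (\big[maxe/0%E]_(1 <= k < n.+1) f k <= M)%E.
Proof.
move=> M0 fM; rewrite big_seq; elim/big_ind: _ => // [x y xM yM|k].
  by rewrite ge_max xM.
by rewrite mem_index_iota => /fM.
Qed.

Lemma le_bigmaxe n (f : nat -> \bar R) k : (1 <= k <= n)%N ->
  (f k <= \big[maxe/0%E]_(1 <= k < n.+1) f k)%E.
Proof. by move=> kn; apply: le_bigmax_seq; rewrite ?mem_index_iota. Qed.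

Lemma bigmaxe_ge0 n (f : nat -> \bar R) : (0 <= \big[maxe/0%E]_(1 <= k < n.+1) f k)%E.
Proof. exact: bigmax_ge_id. Qed.

Lemma slow_norm_le (A B : R) : 0 <= A -> 0 <= B ->
  (forall (t : R) k, 0 <= t -> t <= 1 -> (1 <= k <= N)%N -> lbound (@beta t k) A) ->
  (forall (s t : R) k, 0 <= s -> s < t -> t <= 1 -> (1 <= k <= N)%N ->
    lbound (@defect R V T U N X beta s t k) (B * w s t `^ (theta - k%:R / p))) ->
  (slow_norm p X beta w theta <= (A + B)%:E)%E.
Proof.
move=> A0 B0 hA hB; rewrite EFinD; apply: leeD.
  apply: ge_ereal_sup => _ [t /= /andP[t0 t1] <-].
  by apply: bigmaxe_le => // k kN; apply: opnorm_le => //; exact: hA.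
apply: bigmaxe_le => // k kN; apply: ge_ereal_sup => _ [[s t] /= [s0 st t1] <-].
have := hB s t k s0 st t1 kN; set d := w s t `^ _ => hd.
have d0 : 0 <= d by exact: powR_ge0.
have := opnorm_le (mulr_ge0 B0 d0) hd; set o := opnorm _ => oB.
(* A zero denominator forces a zero defect by [hB], and 0 / 0 = 0 here. *)
rewrite inver; case: eqP => [d00|/eqP dn0].
  suff -> : o = 0%E by rewrite mul0e lee_fin.
  by apply/eqP; rewrite eq_le opnorm_ge0 andbT (le_trans oB)// d00 mulr0.
by rewrite lee_pdivrMr ?lt_neqAle ?d0 1?eq_sym ?dn0// -EFinM.
Qed.

Hypothesis Hbeta : one_form p beta.
Hypothesis fin : (slow_norm p X beta w theta < +oo)%E.

Lemma slow_norm_bounds : (forall s t : R, 0 <= s -> s < t -> t <= 1 ->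
    forall k, (1 <= k <= N)%N -> linear (@defect R V T U N X beta s t k)) ->
  exists M : R, [/\ slow_norm p X beta w theta = M%:E, 0 <= M,
    forall (t : R) k, 0 <= t -> t <= 1 -> (1 <= k <= N)%N -> lbound (@beta t k) M
  & forall (s t : R) k, 0 <= s -> s < t -> t <= 1 -> (1 <= k <= N)%N ->
    lbound (@defect R V T U N X beta s t k) (M * w s t `^ (theta - k%:R / p))].
Proof.
move=> lind; move: fin; rewrite /slow_norm -/N; set a := ereal_sup _; set b := bigop.body _ _ _.
have a0 : (0 <= a)%E.
  apply: (@le_trans _ _ (form_norm N (beta 0))); first exact: bigmaxe_ge0.
  by apply: ereal_sup_ubound; exists 0 => //=; rewrite lexx ler01.
have b0 : (0 <= b)%E by exact: bigmaxe_ge0.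
move=> ab; have af : a \is a fin_num.
  by rewrite ge0_fin_numE// (le_lt_trans _ ab)// leeDl.
have bf : b \is a fin_num.
  by rewrite ge0_fin_numE// (le_lt_trans _ ab)// leeDr.
have fa0 := fine_ge0 a0; have fb0 := fine_ge0 b0.
have aM : (a <= (fine a + fine b)%:E)%E by rewrite EFinD !fineK// leeDl.
have bM : (b <= (fine a + fine b)%:E)%E by rewrite EFinD !fineK// leeDr.
exists (fine a + fine b); split.
- by rewrite EFinD !fineK.
- exact: addr_ge0.
- move=> t k t0 t1 kN; apply: lbound_opnorm.
    have t01 : 0 <= t <= 1 by rewrite t0.
    by case: (Hbeta t01 kN).
  apply: le_trans aM; apply: (@le_trans _ _ (form_norm N (beta t))).
    exact: le_bigmaxe.
  by apply: ereal_sup_ubound; exists t => //=; rewrite t0.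
move=> s t k s0 st t1 kN; apply: lbound_opnorm; first exact: lind.
set d := w s t `^ _; set o := opnorm _.
have oM : (o / d%:E <= (fine a + fine b)%:E)%E.
  apply: le_trans bM; apply: le_trans (le_bigmaxe _ kN).
  by apply: ereal_sup_ubound; exists (s, t).
have d0 : 0 <= d by exact: powR_ge0.
(* Over a zero denominator a nonzero defect would have ratio [+oo], against the finite norm. *)
move: oM; rewrite inver; case: eqP => [d00|/eqP dn0]; last first.
  by rewrite lee_pdivrMr ?lt_neqAle ?d0 1?eq_sym ?dn0// -EFinM.
have := opnorm_ge0 (@defect R V T U N X beta s t k); rewrite -/o le_eqVlt => /predU1P[<- _|o0].
  by rewrite lee_fin mulr_ge0// addr_ge0.
by rewrite gt0_muley// leye_eq.
Qed.

End SlowNorm.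

(** * The integral as a component of degree zero *)

Section DegreeZero.
Context {R : realType} {V : completeNormedModType R} {T : tensor_powers V}.
Let one : T 0%N := tpure T [tuple].

Let norm_scale (r : R) : `|r *: one| = `|r|.
Proof. by rewrite normrZ norm_tpure0 mulr1. Qed.

(* The line through the unit is closed, being a union of compact segments, and
   it is dense. *)
Lemma tpow0_scalar (y : T 0%N) : exists r : R, y = r *: one.
Proof.
pose M := `|y| + 1; pose f (r : R) : T 0%N := r *: one.
have cf : continuous f.
  by move=> r; apply: cvgZr_tmp; exact: cvg_id.
have cK : compact (f @` `[- M, M]).
  apply: continuous_compact; last exact: segment_compact.
  exact: continuous_subspaceT.
have clK := compact_closed (@norm_hausdorff _ _) cK.
have : closure (f @` `[- M, M]) y.
  move=> B /nbhs_ballP[e /= e0 eB].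
  pose d := Num.min e 1.
  have d0 : 0 < d by rewrite lt_min e0 ltr01.
  have yB : ball y d !=set0 by exists y; exact: ballxx.
  have [z [yz [s _ zs]]] := tpure_dense yB (ball_open y _).
  have zE : z = (\sum_(q <- s) q.1) *: one.
    rewrite -zs scaler_suml; apply: eq_bigr => q _.
    by congr (_ *: tpure T _); rewrite tuple0.
  move: yz; rewrite -ball_normE /ball_ /= lt_min => /andP[ye y1].
  exists z; split; last by apply: eB; rewrite -ball_normE.
  exists (\sum_(q <- s) q.1); last by rewrite zE.
  rewrite /= in_itv /= -ler_norml -norm_scale -zE /M.
  by rewrite -[z](subKr y) (le_trans (ler_normB _ _))// lerD2l ltW.
by move: clK; rewrite closure_id => <- [r _ <-]; exists r.
Qed.

Definition tcoef (y : T 0%N) : R := sval (cid (tpow0_scalar y)).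

Lemma tcoefE y : y = tcoef y *: one.
Proof. by rewrite /tcoef; case: cid. Qed.

Lemma norm_tcoef y : `|tcoef y| = `|y|.
Proof. by rewrite [in RHS](tcoefE y) norm_scale. Qed.

Lemma tcoefK r : tcoef (r *: one) = r.
Proof.
apply/eqP; rewrite -subr_eq0 -normr_le0 -norm_scale scalerBl -tcoefE.
by rewrite subrr normr0.
Qed.

Lemma linear_tcoef (U : lmodType R) (u : U) : linear (fun y => tcoef y *: u).
Proof.
move=> a x y; rewrite scalerA -scalerDl; congr (_ *: _).
by rewrite -[RHS]tcoefK scalerDl -scalerA -!tcoefE.
Qed.

End DegreeZero.

Section HalfShuffleZero.
Context {R : realType} {V : completeNormedModType R} {T : tensor_powers V}.

Lemma tact1 k (y : T k) : tact 1%g y = y.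
Proof.
move: y; apply: clinear_tpure_eq.
- apply: (@lbound_clinear _ _ _ _ 1); first exact: tact_linear.
  by move=> x; rewrite norm_tact mul1r.
- by apply: (@lbound_clinear _ _ _ _ 1) => // x; rewrite mul1r.
move=> v; rewrite tact_tpure; congr tpure.
by apply: eq_from_tnth => i; rewrite tnth_mktuple perm1.
Qed.

(** With an empty first word all masks are constantly [false], and a shuffle is determined by its
    mask. *)
Lemma Shlast0 k : (0 < k)%N -> Shlast 0 k = [set (1%g : 'S_(0 + k))]%SET.
Proof.
move=> k0; have w1 : pword (1%g : 'S_(0 + k)) = iota 0 k.
  by rewrite -val_enum_ord; apply: eq_map => i; rewrite perm1.
have S1 : 1%g \in Sh 0 k by rewrite inE w1 sub0seq subseq_refl.
apply/setP => tau; rewrite !inE.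
apply/idP/eqP => [/andP[tS _]|->]; last first.
  by rewrite w1 sub0seq subseq_refl -nth_last size_iota nth_iota ?prednK// eqxx.
apply: (@shmask_inj 0 k) => //; first by rewrite inE.
apply: (@eq_from_nth _ false); rewrite !size_shmask// => i ik.
by rewrite !(nth_map 0%N) ?size_pword.
Qed.

(** Through this the term u (x) phi of the iterated form becomes the summand of a half-shuffle
    product whose first factor has degree 0. *)
Lemma shuf0 k (y : T k) : (0 < k)%N -> shuf true (y : T (0 + k)) = y.
Proof. by move=> k0; rewrite /shuf Shlast0// big_set1 invg1 tact1. Qed.

End HalfShuffleZero.

Section Extension.
Context {R : realType} {V : completeNormedModType R} {T : tensor_powers V}.
Context {U : completeNormedModType R}.
Implicit Types (phi : eform T U) (u : U).

(* The form [x |-> u + phi(x)], truncated above degree [N]: the constant term of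
   the integral becomes the component of degree [0]. *)
Definition eform_ext (N : nat) u phi : eform T U := fun k =>
  match k return T k -> U with
  | 0 => fun y => tcoef y *: u
  | k'.+1 => fun y => if (k' < N)%N then phi k'.+1 y else 0
  end.

(** The form x |-> phi(b x), with phi(b) not subtracted. The range of i is the same in all degrees,
    since a truncated form kills the terms with i + k > N; the product of two shifts is then a sum
    over a full square of indices. *)
Definition eform_shift (N : nat) phi (b : tseries T) : eform T U :=
  fun k y => \sum_(i < N.+1) fpre (b i) phi y.

Lemma eform_extE N u phi k (y : T k) : (1 <= k <= N)%N -> eform_ext N u phi y = phi k y.
Proof. by case: k y => // k y /=; case: ltnP. Qed.

Lemma eform_ext_gt N u phi k (y : T k) : (N < k)%N -> eform_ext N u phi y = 0.
Proof. by case: k y => // k y /=; case: ltnP => //; lia. Qed.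

Lemma lbound_eform_ext N u phi c : 0 <= c -> `|u| <= c ->
  (forall k, (1 <= k <= N)%N -> lbound (phi k) c) ->
  forall k, lbound (@eform_ext N u phi k) c.
Proof.
move=> c0 uc bphi [|k] y /=.
  by rewrite normrZ norm_tcoef mulrC ler_wpM2r.
by case: ifP => kN; [exact: bphi|rewrite normr0 mulr_ge0].
Qed.

Lemma clin_eform_ext N u phi : is_eform N phi -> clin_form (eform_ext N u phi).
Proof.
move=> ephi [|k].
  apply: (@lbound_clinear _ _ _ _ `|u|); first exact: linear_tcoef.
  by move=> y /=; rewrite normrZ norm_tcoef mulrC.
rewrite /=; case: (boolP (k < N)%N) => kN; last exact: clinear_zero.
exact: ephi.
Qed.

Lemma clin_eform_shift N phi b : clin_form phi -> clin_form (eform_shift N phi b).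
Proof. by move=> cphi k; apply: clinear_sum => i _; exact: clin_fpre. Qed.

Lemma lbound_fpre phi n (z : T n) k c : 0 <= c -> lbound (phi (n + k)%N) c ->
  lbound (fun y : T k => fpre z phi y) (c * `|z|).
Proof.
by move=> c0 bphi; apply: (lbound_comp (g := fun y => tmul z y) c0 bphi);
   exact: lbound_tmul.
Qed.

Lemma eform_shift_translate N u phi b k (y : T k) : (1 <= k <= N)%N ->
  eform_shift N (eform_ext N u phi) b y = translate N phi b k y.
Proof.
move=> /andP[k1 kN]; rewrite /eform_shift /translate.
rewrite (big_ord_widen N.+1 (fun i => phi (i + k)%N (tmul (b i) y))); last by lia.
rewrite [RHS]big_mkcond /=; apply: eq_bigr => i _; rewrite /fpre.
case: ifP => ik; first by rewrite eform_extE//; lia.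
by rewrite eform_ext_gt//; lia.
Qed.

Lemma eform_shift0 N u phi b (y : T 0%N) : is_eform N phi ->
  b 0%N = tpure T [tuple] ->
  eform_shift N (eform_ext N u phi) b y = tcoef y *: (u + form_eval N phi b).
Proof.
move=> ephi b0; have cext := clin_eform_ext u ephi.
rewrite {1}[y]tcoefE /eform_shift.
have E i : fpre (b i) (eform_ext N u phi) (tcoef y *: tpure T [tuple]) =
    tcoef y *: eform_ext N u phi (b i).
  rewrite (linZ (clin_fpre (b i) cext 0%N).1); congr (_ *: _).
  by rewrite /fpre -[in RHS](tmulx1 (b i)) eform_tcastp.
transitivity (\sum_(i < N.+1) tcoef y *: eform_ext N u phi (b i)).
  by apply: eq_bigr => i _; exact: E.
rewrite -scaler_sumr big_ord_recl b0 /=; congr (_ *: (_ + _)).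
  by rewrite -[tpure _ _]scale1r tcoefK scale1r.
rewrite /form_eval big_add1 big_mkord; apply: eq_bigr => i _.
by apply: (@eform_extE N u phi i.+1 (b i.+1)); exact: ltn_ord.
Qed.

Lemma clinear_translate N phi b k : is_eform N phi -> (1 <= k <= N)%N ->
  clinear (translate N phi b k).
Proof.
move=> ephi kN; apply: clinear_sum => i _.
apply: (clinear_comp (f := phi (i + k)%N)); last exact: clinear_tmul.
by apply: ephi; have := ltn_ord i; lia.
Qed.

End Extension.

Section IteratedForm.
Context {R : realType} {V : completeNormedModType R} {T : tensor_powers V}.
Context {U1 U2 : completeNormedModType R} {W : tensor_product U1 U2}.
Hypothesis hW : tensor_maps_bounded T W.

(** The summand j = 0 is the tensor with I, by [shuf0], and the summands 0 < j < k are those of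
    [trunc_prod]. As j = k is absent, the constant 0 of the second factor is never evaluated. *)
Lemma shprod_ext N (I : U1) (phi : eform T U1) (psi : eform T U2) k (y : T k) :
  is_eform N phi -> is_eform N psi -> (1 <= k <= N)%N ->
  shprod W true (eform_ext N I phi) (eform_ext N 0 psi) k y =
  tens W I (psi k y) + trunc_prod W phi psi k y.
Proof.
move=> ephi epsi; case: k y => // k y kN.
have c1 := clin_eform_ext I ephi; have c2 := clin_eform_ext 0 epsi.
(* With [tproj] the summand is a function of j alone, so the term j = 0 can be split off without
   matching casts. *)
pose G j : W := tensor_map W
  (@eform_ext _ _ _ _ N I phi j) (@eform_ext _ _ _ _ N 0 psi (k.+1 - j)%N)
  (shuf true (tproj (j + (k.+1 - j))%N y)).
have -> : shprod W true (eform_ext N I phi) (eform_ext N 0 psi) k.+1 y = \sum_(j < k.+1) G j.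
  rewrite /shprod big_mkcond big_ord_recr /= ltnn addr0.
  apply: eq_bigr => j _; rewrite ltn_ord /G.
  by rewrite (tproj_eq (esym (subnKC (ltnW (ltn_ord j)))));
    congr (tensor_map _ _ _ (shuf _ (tcastp _ _))); exact: eq_irrelevance.
rewrite big_ord_recl; congr (_ + _).
  have hy : shuf true (tproj (0 + k.+1) y) = tmul (tpure T [tuple]) y.
    by rewrite tproj_id shuf0// -[RHS](tproj_id (n := k.+1)) tproj_tmul1l tproj_id.
  transitivity (tensor_map W (@eform_ext _ _ _ _ N I phi 0%N)
      (@eform_ext _ _ _ _ N 0 psi k.+1) (tmul (tpure T [tuple]) y)).
    by rewrite -hy.
  transitivity (tens W (@eform_ext _ _ _ _ N I phi 0%N (tpure T [tuple]))
      (@eform_ext _ _ _ _ N 0 psi k.+1 y)).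
    exact: (tensor_mapP hW (c1 0%N) (c2 k.+1)).2.
  rewrite (@eform_extE _ _ _ _ N 0 psi k.+1)//; congr (tens W _ _) => /=.
  by rewrite -[tpure _ _]scale1r tcoefK scale1r.
rewrite /trunc_prod [RHS]big_mkcond [RHS]big_ord_recl /= add0r; apply: eq_bigr => j _.
have ext (U : completeNormedModType R) (u : U) (f : eform T U) m :
    (1 <= m <= N)%N -> @eform_ext _ _ _ _ N u f m = f m.
  by move=> mN; apply: funext => z; exact: eform_extE.
rewrite /G !ext; [|by rewrite /bump /=; have := ltn_ord j; lia..].
by rewrite (tproj_eq (esym (subnKC (ltnW (ltn_ord (lift ord0 j)))))).
Qed.

End IteratedForm.

(** * Estimates *)

Section PowerBounds.
Context {R : realType}.
Implicit Types x a b H : R.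

(** An exponent above the target is lowered at the cost of powers of H >= 1. The margin 3 is ample:
    the excess is (k - j)/p <= 1 in the products with a defect, and less than i/p + j/p <= 2 in the
    truncated terms. *)
Lemma powR_slack x a b H : 0 <= x -> x <= H -> 1 <= H -> 0 < a -> a <= b ->
  b <= a + 3 -> x `^ b <= H ^+ 3 * x `^ a.
Proof.
move=> x0 xH H1 a0 ab ba.
have -> : b = (b - a) + a by rewrite subrK.
rewrite powRD; last by apply/implyP => /eqP; lra.
rewrite ler_wpM2r ?powR_ge0//.
apply: (@le_trans _ _ (H `^ (b - a))); first by apply: powR_mono; lra.
by rewrite -powR_mulrn ?ler_powR//; lra.
Qed.

Lemma ler_powR_small x a b : 0 <= x -> x <= 1 -> 0 < b -> b <= a ->
  x `^ a <= x `^ b.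
Proof.
move=> x0 x1 b0 ba; move: x0; rewrite le_eqVlt => /predU1P[<-|x0].
  by rewrite !powR0//; apply: lt0r_neq0; lra.
by apply: ger_powR => //; rewrite x0.
Qed.

End PowerBounds.

Lemma ord_sub_bounds n k : (1 <= k <= n)%N -> forall i : 'I_(n - k).+1,
  (1 <= i + k <= n)%N /\ (i <= n)%N.
Proof. by move=> kn i; have := ltn_ord i; lia. Qed.

Section OneFormEstimates.
Context {R : realType} {V : completeNormedModType R} {T : tensor_powers V}.
Context {U : completeNormedModType R} (p : R) (X : R -> tseries T).
Hypothesis p1 : (1 <= p :> R).
Hypothesis HX : geometric_rough_path p X.
Let N := Num.truncn p.

Lemma truncn_div_le1 k : (k <= N)%N -> k%:R / p <= 1.
Proof.
move=> kN; have p0 : 0 < p by exact: lt_le_trans ltr01 p1.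
rewrite ler_pdivrMr// mul1r (le_trans (_ : k%:R <= N%:R))// ?ler_nat//.
by rewrite truncn_le// ltW.
Qed.

Lemma div_p_ge0 k : 0 <= k%:R / p.
Proof. by rewrite divr_ge0// (le_trans ler01 p1). Qed.

(** The way in which the size of the path enters the estimates. It is applied both to the w of the
    theorem and to the control from which existence of the integral is deduced. *)
Definition drives (w : R -> R -> R) := superadditive w /\
  forall s t k, 0 <= s -> s < t -> t <= 1 -> `|pincr X s t k| <= w s t `^ (k%:R / p).

Context (beta : R -> eform T U) (w : R -> R -> R).
Hypothesis Hbeta : one_form p beta.
Hypothesis dw : drives w.
Let H := 1 + w 0 1.

Let w0 s t : 0 <= s -> s <= t -> t <= 1 -> 0 <= w s t.
Proof. exact: (superadd_ge0 dw.1). Qed.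

Lemma drives_H_ge1 : 1 <= H.
Proof. by rewrite lerDl w0. Qed.
Let H1 := drives_H_ge1.

Lemma drives_le_H s t : 0 <= s -> s <= t -> t <= 1 -> w s t <= H.
Proof.
move=> s0 st t1; apply: (@le_trans _ _ (w 0 1)).
  exact: (superadd_mono dw.1).
by rewrite lerDr.
Qed.

Lemma norm_pincr_le_H s t k : 0 <= s -> s < t -> t <= 1 -> (k <= N)%N ->
  `|pincr X s t k| <= H.
Proof.
move=> s0 st t1 kN; apply: le_trans (dw.2 s t k s0 st t1) _.
apply: (@le_trans _ _ (H `^ (k%:R / p))).
  by apply: powR_mono; [exact: div_p_ge0|apply: w0 => //; exact: ltW|
    apply: drives_le_H => //; exact: ltW].
by apply: ler1_powR => //; exact: truncn_div_le1.
Qed.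

Lemma clinear_defect s t k : 0 <= s <= 1 -> 0 <= t <= 1 -> (1 <= k <= N)%N ->
  clinear (@defect R V T U N X beta s t k).
Proof.
move=> s01 t01 kN; apply: clinear_sub; first exact: Hbeta.
by apply: clinear_translate => //; exact: Hbeta.
Qed.

(** The crude bound of a defect by the sup norm: 1 for the form itself, and at most n + 1 terms of a
    translate, each with a factor |b^i| <= h. *)
Definition defect_const (n : nat) (h : R) : R := 1 + n.+1%:R * h.

Lemma defect_const_ge1 n h : 0 <= h -> 1 <= defect_const n h.
Proof. by move=> h0; rewrite lerDl mulr_ge0. Qed.

(* Where [w1 > 1] the bound comes from the sup norm of the form, so that the
   constant does not depend on [theta1]. *)
Lemma defect_bound (M theta theta1 : R) (w1 : R -> R -> R) : 0 <= M ->
  1 < theta -> theta <= theta1 ->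
  (forall s t : R, 0 <= s -> s < t -> t <= 1 -> 0 <= w1 s t <= w s t) ->
  (forall (t : R) k, 0 <= t -> t <= 1 -> (1 <= k <= N)%N -> lbound (@beta t k) M) ->
  (forall (s t : R) k, 0 <= s -> s < t -> t <= 1 -> (1 <= k <= N)%N ->
    lbound (@defect R V T U N X beta s t k) (M * w1 s t `^ (theta1 - k%:R / p))) ->
  forall (s t : R) k, 0 <= s -> s < t -> t <= 1 -> (1 <= k <= N)%N ->
    lbound (@defect R V T U N X beta s t k)
      (defect_const N H * M * w s t `^ (theta - k%:R / p)).
Proof.
move=> M0 th th1 w1w bM bD s t k s0 st t1 kN.
have kp : k%:R / p <= 1 by apply: truncn_div_le1; case/andP: kN.
have /andP[w10 w1le] := w1w s t s0 st t1.
have c1 : 1 <= defect_const N H by apply: defect_const_ge1; exact: le_trans ler01 H1.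
have c0 : 0 <= defect_const N H by exact: le_trans ler01 c1.
have e0 : 0 < theta - k%:R / p by lra.
have [w11|w11] := leP (w1 s t) 1.
  apply: lbound_le (bD s t k s0 st t1 kN) _.
  apply: (@le_trans _ _ (M * w s t `^ (theta - k%:R / p))).
    rewrite ler_wpM2l//; apply: (@le_trans _ _ (w1 s t `^ (theta - k%:R / p))).
      by apply: ler_powR_small => //; lra.
    by apply: powR_mono => //; exact: ltW.
  by rewrite ler_wpM2r ?powR_ge0// ler_peMl.
apply: (@lbound_le _ _ _ _ (defect_const N H * M)); last first.
  have ws1 : 1 <= w s t by exact: ltW (lt_le_trans w11 w1le).
  apply: ler_peMr; first exact: mulr_ge0.
  by rewrite -[leLHS](powRr0 (w s t)); apply: ler_powR => //; exact: ltW.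
have -> : defect_const N H * M = M + M * H *+ N.+1.
  by rewrite /defect_const -mulr_natl; ring.
have s1 : s <= 1 by lra. have t0 : 0 <= t by lra.
apply: lbound_sub; first exact: bM.
apply: (@lbound_le _ _ _ _ (\sum_(i < (N - k).+1) M * H)); last first.
  rewrite sumr_const card_ord -[leLHS]mulr_natl -[leRHS]mulr_natl.
  by rewrite ler_wpM2r ?mulr_ge0 ?(le_trans ler01 H1)// ler_nat ltnS leq_subr.
apply: lbound_sum => i _.
apply: (@lbound_comp _ _ _ _ (@beta s (i + k)%N) (fun y => tmul (pincr X s t i) y)) => //.
  exact: (bM s (i + k)%N s0 s1 (ord_sub_bounds kN i).1).
have iN := (ord_sub_bounds kN i).2.
exact: lbound_le (@lbound_tmul _ _ _ _ _ _) (norm_pincr_le_H s0 st t1 iN).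
Qed.

Let Xi s t : U := form_eval N (beta s) (pincr X s t).

Lemma form_eval_pincr_diag t : 0 <= t -> t <= 1 -> Xi t t = 0.
Proof.
move=> t0 t1; have t01 : 0 <= t <= 1 by rewrite t0.
rewrite /Xi (pincr_diag HX)// /form_eval big_nat big1// => -[//|k] kN.
by apply: lin0; case: (Hbeta t01 kN).
Qed.

Lemma form_eval_bound (M s t : R) : 0 <= M -> 0 <= s -> s <= t -> t <= 1 ->
  (forall (t : R) k, 0 <= t -> t <= 1 -> (1 <= k <= N)%N -> lbound (@beta t k) M) ->
  `|Xi s t| <= N%:R * M * H.
Proof.
move=> M0 s0 st t1 bM; have MH : 0 <= M * H by rewrite mulr_ge0// (le_trans ler01 H1).
move: st; rewrite le_eqVlt => /predU1P[st|st].
  rewrite -st form_eval_pincr_diag//; last by rewrite st.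
  by rewrite normr0 -mulrA mulr_ge0.
rewrite /Xi /form_eval (le_trans (ler_norm_sum _ _ _))//.
rewrite -mulrA mulr_natl -[X in _ *+ X](subn1 N.+1) -sumr_const_nat.
rewrite big_nat [leRHS]big_nat; apply: ler_sum => k kN.
have s1 : s <= 1 by rewrite ltW// (lt_le_trans st).
rewrite (le_trans (bM s k s0 s1 kN _))// ler_wpM2l// norm_pincr_le_H//.
by case/andP: kN.
Qed.

(** By Chen's relation the additivity error is minus the value at X_{u,t} of the defect over [s, u];
    in each degree the exponents theta - k/p and k/p add up to theta. *)
Lemma form_eval_almost_additive (c theta : R) : 0 <= c -> 1 < theta ->
  (forall (s t : R) k, 0 <= s -> s < t -> t <= 1 -> (1 <= k <= N)%N ->
    lbound (@defect R V T U N X beta s t k) (c * w s t `^ (theta - k%:R / p))) ->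
  forall s u t : R, 0 <= s -> s < u -> u < t -> t <= 1 ->
    `|Xi s t - (Xi s u + Xi u t)| <= N%:R * c * w s t `^ theta.
Proof.
move=> c0 th bD s u t s0 su ut t1.
have u0 : 0 <= u by lra. have u1 : u <= 1 by lra.
have [s01 u01 t01] : [/\ 0 <= s <= 1, 0 <= u <= 1 & 0 <= t <= 1] by split; lra.
have -> : Xi s t - (Xi s u + Xi u t) =
    - \sum_(1 <= k < N.+1) @defect R V T U N X beta s u k (pincr X u t k).
  have := form_eval_translate (pincr X s u) (Hbeta s01) (pincr_0 HX u01 t01).
  rewrite (pincr_chen HX)// -/(Xi s t) -/(Xi s u) => /esym/eqP.
  rewrite subr_eq => /eqP ->; rewrite [Xi s u + _]addrC opprD addrACA subrr addr0.
  by rewrite /Xi /form_eval -sumrB -sumrN; apply: eq_bigr => k _; rewrite /defect opprB.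
rewrite normrN (le_trans (ler_norm_sum _ _ _))//.
rewrite -mulrA mulr_natl -[X in _ *+ X](subn1 N.+1) -sumr_const_nat.
rewrite big_nat [leRHS]big_nat; apply: ler_sum => k kN.
have kp : k%:R / p <= 1 by apply: truncn_div_le1; case/andP: kN.
have wsu : w s u <= w s t by apply: (superadd_mono dw.1) => //; lra.
have wut : w u t <= w s t by apply: (superadd_mono dw.1) => //; lra.
have wsu0 : 0 <= w s u by apply: w0; lra.
have wut0 : 0 <= w u t by apply: w0; lra.
apply: le_trans (bD s u k s0 su u1 kN _) _.
rewrite -mulrA ler_wpM2l//.
have -> : w s t `^ theta = w s t `^ (theta - k%:R / p) * w s t `^ (k%:R / p).
  by rewrite -powRD subrK//; apply/implyP => /eqP; lra.
rewrite ler_pM ?powR_ge0//.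
  by apply: powR_mono => //; lra.
apply: le_trans (dw.2 u t k u0 ut t1) _.
by apply: powR_mono => //; exact: div_p_ge0.
Qed.

End OneFormEstimates.

(** * The defect of the iterated form *)

Section IteratedDefect.
Context {R : realType} {V : completeNormedModType R} {T : tensor_powers V}.
Context {U1 U2 : completeNormedModType R} {W : tensor_product U1 U2}.
Hypothesis hW : tensor_maps_bounded T W.

Lemma lbound_shprod_unif N k (phi : eform T U1) (psi : eform T U2)
    (c d : nat -> R) (E : R) : (k <= N)%N ->
  clin_form phi -> clin_form psi ->
  (forall j, 0 <= c j) -> (forall j, 0 <= d j) -> 0 <= E ->
  (forall j, (j <= k)%N -> lbound (@phi j) (c j)) ->
  (forall j, (1 <= j <= k)%N -> lbound (@psi j) (d j)) ->
  (forall j, (j < k)%N -> c j * d (k - j)%N <= E) ->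
  lbound (shprod W true phi psi k) (N.+1%:R * (N`!)%:R * E).
Proof.
move=> kN cphi cpsi c0 d0 E0 bphi bpsi cdE.
have b2 j : (0 < j <= k)%N || ~~ true && (j == 0%N) -> lbound (@psi j) (d j).
  by rewrite orbF; exact: bpsi.
apply: lbound_le (lbound_shprod hW cphi cpsi c0 d0 bphi b2) _.
apply: (@le_trans _ _ (\sum_(j < k.+1) E * (N`!)%:R)); last first.
  rewrite sumr_const card_ord -[leLHS]mulr_natl -mulrA [(N`!)%:R * E]mulrC.
  by rewrite ler_wpM2r ?mulr_ge0// ler_nat.
rewrite big_mkcond /=; apply: ler_sum => j _; case: ifP => jk; last by rewrite mulr_ge0.
apply: ler_pM => //; first by rewrite mulr_ge0.
  exact: cdE.
by rewrite ler_nat leq_fact.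
Qed.

Section Identity.
Context (N : nat) (I : R -> U1) (beta1 : R -> eform T U1) (beta2 : R -> eform T U2).
Context (X : R -> tseries T) (s t : R).
Let b := pincr X s t.
Hypothesis gb : weakly_grouplike (W := W) b.
Hypothesis e1 : forall r, r \in [:: s; t] -> is_eform N (beta1 r).
Hypothesis e2 : forall r, r \in [:: s; t] -> is_eform N (beta2 r).

(** The iterated form with an arbitrary function [I] in place of the integral, of which only size
    and increments matter for the estimates. *)
Definition indef_form : R -> eform T W := fun r k y =>
  tens W (I r) (beta2 r y) + trunc_prod W (beta1 r) (beta2 r) k y.

Let Phi r := eform_ext N (I r) (beta1 r).
Let Psi r := eform_ext N 0 (beta2 r).

Lemma iterated_defectE k (y : T k) : (1 <= k <= N)%N ->
  @defect R V T W N X indef_form s t k y =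
    shprod W true (fsub (Phi t) (eform_shift N (Phi s) b)) (Psi t) k y
  + shprod W true (eform_shift N (Phi s) b) (fsub (Psi t) (eform_shift N (Psi s) b)) k y
  + \sum_(i < N.+1) \sum_(j < N.+1) if (N - k < i + j)%N then
      shprod W true (fpre (b i) (Phi s)) (fpre (b j) (Psi s)) k y else 0.
Proof.
move=> kN.
have st_s : s \in [:: s; t] by rewrite mem_head.
have st_t : t \in [:: s; t] by rewrite !inE eqxx orbT.
have cPhi r : r \in [:: s; t] -> clin_form (Phi r) by move=> /e1/(clin_eform_ext (I r)).
have cPsi r : r \in [:: s; t] -> clin_form (Psi r) by move=> /e2/(clin_eform_ext 0).
have cP1 := clin_eform_shift N b (cPhi _ st_s).
have cP2 := clin_eform_shift N b (cPsi _ st_s).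
have cf1 i : clin_form (fpre (b i) (Phi s)) by apply: clin_fpre; exact: cPhi.
have cf2 i : clin_form (fpre (b i) (Psi s)) by apply: clin_fpre; exact: cPsi.
pose S i j := shprod W true (fpre (b i) (Phi s)) (fpre (b j) (Psi s)) k y.
have indefE r n (z : T n) : r \in [:: s; t] -> (1 <= n <= N)%N ->
    indef_form r z = shprod W true (Phi r) (Psi r) n z.
  by move=> rst nN; rewrite shprod_ext//; [exact: e1|exact: e2].
(* The translate keeps the pairs i + j <= N - k, the product of the two shifts all pairs i, j <= N;
   their difference is the sum lost by truncation. *)
have trE : translate N (indef_form s) b k y =
    \sum_(i < N.+1) \sum_(j < N.+1) if (i + j <= N - k)%N then S i j else 0.
  rewrite -(sum_antidiag_trunc S (leq_subr k N)) /translate.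
  apply: eq_bigr => a _; rewrite indefE//; last exact: (ord_sub_bounds kN a).1.
  by rewrite shprod_tmul//; [exact: cPhi|exact: cPsi|by case/andP: kN].
have fullE : shprod W true (eform_shift N (Phi s) b) (eform_shift N (Psi s) b) k y =
    \sum_(i < N.+1) \sum_(j < N.+1) S i j.
  rewrite shprod_suml//; apply: eq_bigr => i _.
  by rewrite shprod_sumr.
rewrite /defect indefE// -/b trE.
rewrite shprod_subl//; [|exact: cPhi|exact: cPsi].
rewrite shprod_subr//; last exact: cPsi.
rewrite subrKA fullE -addrA; congr (_ + _).
rewrite -sumrN -sumrN -big_split /=; apply: eq_bigr => i _.
rewrite -!sumrN -big_split /=; apply: eq_bigr => j _.
by rewrite -/(S i j); case: leqP => _; rewrite ?oppr0 ?addr0// addNr.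
Qed.

End Identity.

End IteratedDefect.

Section IteratedBound.
Context {R : realType} {V : completeNormedModType R} {T : tensor_powers V}.
Context {U1 U2 : completeNormedModType R} {W : tensor_product U1 U2}.
Hypothesis hW : tensor_maps_bounded T W.
Context (p : R) (X : R -> tseries T).
Hypothesis p1 : (1 <= p :> R).
Hypothesis HX : geometric_rough_path p X.
Let N := Num.truncn p.
Context (I : R -> U1) (beta1 : R -> eform T U1) (beta2 : R -> eform T U2).
Hypothesis Hbeta1 : one_form p beta1.
Hypothesis Hbeta2 : one_form p beta2.
Context (w : R -> R -> R).
Hypothesis dw : drives p X w.
Let H := 1 + w 0 1.
Context (theta B M E F : R).
Hypothesis theta1 : (1 < theta :> R).
Hypothesis thetaN : (theta <= N.+1%:R / p :> R).
Hypothesis B0 : (0 <= B :> R).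
Hypothesis M0 : (0 <= M :> R).
Hypothesis E0 : (0 <= E :> R).
Hypothesis F0 : (0 <= F :> R).
Hypothesis bI : forall t : R, 0 <= t -> t <= 1 -> `|I t| <= B.
Hypothesis b1 : forall (t : R) k, 0 <= t -> t <= 1 -> (1 <= k <= N)%N ->
  lbound (@beta1 t k) B.
Hypothesis b2 : forall (t : R) k, 0 <= t -> t <= 1 -> (1 <= k <= N)%N ->
  lbound (@beta2 t k) M.
Hypothesis dI : forall s t : R, 0 <= s -> s < t -> t <= 1 ->
  `|I t - I s - form_eval N (beta1 s) (pincr X s t)| <= E * w s t `^ theta.
Hypothesis d1 : forall (s t : R) k, 0 <= s -> s < t -> t <= 1 -> (1 <= k <= N)%N ->
  lbound (@defect R V T U1 N X beta1 s t k) (E * w s t `^ (theta - k%:R / p)).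
Hypothesis d2 : forall (s t : R) k, 0 <= s -> s < t -> t <= 1 -> (1 <= k <= N)%N ->
  lbound (@defect R V T U2 N X beta2 s t k) (F * w s t `^ (theta - k%:R / p)).

Let Phi r := eform_ext N (I r) (beta1 r).
Let Psi r := eform_ext N 0 (beta2 r).

Let Phi_bound t k : 0 <= t -> t <= 1 -> lbound (@Phi t k) B.
Proof. by move=> t0 t1; apply: lbound_eform_ext; auto. Qed.

Let Psi_bound t k : 0 <= t -> t <= 1 -> lbound (@Psi t k) M.
Proof. by move=> t0 t1; apply: lbound_eform_ext; rewrite ?normr0; auto. Qed.

Let cPhi t : 0 <= t <= 1 -> clin_form (Phi t).
Proof. by move=> t01; apply: clin_eform_ext; exact: Hbeta1. Qed.

Let cPsi t : 0 <= t <= 1 -> clin_form (Psi t).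
Proof. by move=> t01; apply: clin_eform_ext; exact: Hbeta2. Qed.

Lemma indef_bound t k : 0 <= t -> t <= 1 -> (1 <= k <= N)%N ->
  lbound (@indef_form R V T U1 U2 W I beta1 beta2 t k) (N.+1%:R * (N`!)%:R * (B * M)).
Proof.
move=> t0 t1 kN y; have t01 : 0 <= t <= 1 by rewrite t0.
rewrite /indef_form -(shprod_ext hW _ _ _ _ kN); [|exact: Hbeta1|exact: Hbeta2].
have [_ kN'] := andP kN.
apply: (lbound_shprod_unif hW kN' (cPhi t01) (cPsi t01) (c := fun=> B) (d := fun=> M)) => //.
- exact: mulr_ge0.
- by move=> j _; exact: Phi_bound.
- by move=> j _; exact: Psi_bound.
Qed.

(** The three summands in the constant bound the three terms of [iterated_defectE]; the last one
    counts all (N + 1)^2 pairs (i, j). The factor H^3 comes from [powR_slack]. *)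
Lemma indef_defect_bound (s t : R) k : 0 <= s -> s < t -> t <= 1 -> (1 <= k <= N)%N ->
  lbound (@defect R V T W N X (@indef_form R V T U1 U2 W I beta1 beta2) s t k)
    (N.+1%:R * (N`!)%:R * H ^+ 3 *
      (E * M + N.+1%:R * H * B * F + N.+1%:R ^+ 2 * (B * M))
      * w s t `^ (theta - k%:R / p)).
Proof.
move=> s0 st t1 kN; set q := w s t `^ _.
have th1 := theta1; have thN := thetaN.
have s1 : s <= 1 by lra. have t0 : 0 <= t by lra.
have s01 : 0 <= s <= 1 by rewrite s0. have t01 : 0 <= t <= 1 by rewrite t0.
pose b := pincr X s t.
have gb : weakly_grouplike (W := W) b := pincr_weakly_grouplike HX hW s01 t01.
have bH i : (i <= N)%N -> `|b i| <= H.
  by move=> iN; exact: (norm_pincr_le_H p1 dw s0 st t1 iN).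
have H1 : 1 <= H by exact: (drives_H_ge1 dw).
have H0 : 0 <= H by exact: le_trans ler01 H1.
have q0 : 0 <= q by exact: powR_ge0.
have [k1 kN'] := andP kN.
have wst0 : 0 <= w s t by apply: (superadd_ge0 dw.1) => //; exact: ltW.
have wH : w s t <= H by apply: (drives_le_H dw) => //; exact: ltW.
have Hq0 : 0 <= H ^+ 3 * q by rewrite mulr_ge0// exprn_ge0.
have le1 i : (i <= N)%N -> i%:R / p <= 1 by exact: truncn_div_le1.
have ge0 i : 0 <= i%:R / p by exact: div_p_ge0.
have slack a : theta - k%:R / p <= a -> a <= theta - k%:R / p + 3 ->
    w s t `^ a <= H ^+ 3 * q.
  by move=> h1 h2; apply: powR_slack => //; have := le1 _ kN'; lra.
have slackj j : (j <= k)%N -> w s t `^ (theta - j%:R / p) <= H ^+ 3 * q.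
  move=> jk; have jk' : j%:R / p <= k%:R / p.
    by rewrite ler_wpM2r ?invr_ge0 ?ler_nat// (le_trans ler01 p1).
  by apply: slack; have := le1 _ kN'; have := ge0 j; lra.
have cshP := clin_eform_shift N b (cPhi s01).
have cshQ := clin_eform_shift N b (cPsi s01).
have cdP : clin_form (fsub (Phi t) (eform_shift N (Phi s) b)).
  by apply: clin_fsub => //; exact: cPhi.
have cdQ : clin_form (fsub (Psi t) (eform_shift N (Psi s) b)).
  by apply: clin_fsub => //; exact: cPsi.
have bshP j : lbound (@eform_shift R V T U1 N (Phi s) b j) (N.+1%:R * H * B).
  have -> : N.+1%:R * H * B = \sum_(i < N.+1) B * H.
    by rewrite sumr_const card_ord -[RHS]mulr_natl; ring.
  apply: lbound_sum => i _.
  apply: (@lbound_le _ _ _ _ (B * `|b i|)).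
    by apply: lbound_fpre => //; exact: Phi_bound.
  by rewrite ler_wpM2l// bH// -ltnS ltn_ord.
have bdP j : (j <= N)%N ->
    lbound (@fsub R V T U1 (Phi t) (eform_shift N (Phi s) b) j)
      (E * w s t `^ (theta - j%:R / p)).
  case: j => [_ y|j jN y].
    rewrite mul0r subr0 /fsub eform_shift0; [|exact: Hbeta1|exact: gb.1].
    rewrite /= -scalerBr normrZ norm_tcoef opprD addrA mulrC.
    by rewrite ler_wpM2r// dI.
  rewrite /fsub /Phi eform_shift_translate// eform_extE//.
  exact: d1.
have bdQ j : (1 <= j <= N)%N ->
    lbound (@fsub R V T U2 (Psi t) (eform_shift N (Psi s) b) j)
      (F * w s t `^ (theta - j%:R / p)).
  move=> jN y; rewrite /fsub /Psi eform_shift_translate// eform_extE//.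
  exact: d2.
set P := N.+1%:R * (N`!)%:R.
have P0 : 0 <= P by rewrite mulr_ge0.
have h1 : lbound (shprod W true (fsub (Phi t) (eform_shift N (Phi s) b)) (Psi t) k)
    (P * (E * M * (H ^+ 3 * q))).
  apply: (lbound_shprod_unif hW kN' cdP (cPsi t01)
    (c := fun j => E * w s t `^ (theta - j%:R / p)) (d := fun=> M)) => //.
  - by move=> j; rewrite mulr_ge0 ?powR_ge0.
  - by rewrite !mulr_ge0.
  - by move=> j jk; apply: bdP; exact: leq_trans jk kN'.
  - by move=> j _; exact: Psi_bound.
  - move=> j jk; rewrite mulrAC ler_wpM2l ?mulr_ge0//.
    exact: (slackj _ (ltnW jk)).
have h2 : lbound (shprod W true (eform_shift N (Phi s) b)
    (fsub (Psi t) (eform_shift N (Psi s) b)) k)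
    (P * (N.+1%:R * H * B * F * (H ^+ 3 * q))).
  apply: (lbound_shprod_unif hW kN' cshP cdQ (c := fun=> N.+1%:R * H * B)
    (d := fun j => F * w s t `^ (theta - j%:R / p))) => //.
  - by move=> _; rewrite !mulr_ge0.
  - by move=> j; rewrite mulr_ge0 ?powR_ge0.
  - by rewrite !mulr_ge0.
  - by move=> j /andP[j1 jk]; apply: bdQ; rewrite j1 (leq_trans jk kN').
  - move=> j jk; rewrite mulrA ler_wpM2l ?mulr_ge0//.
    exact: (slackj _ (leq_subr _ _)).
have h3 i j : (i <= N)%N -> (j <= N)%N -> (N - k < i + j)%N ->
    lbound (shprod W true (fpre (b i) (Phi s)) (fpre (b j) (Psi s)) k)
      (P * (B * M * (H ^+ 3 * q))).
  move=> iN jN ijk.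
  apply: (lbound_shprod_unif hW kN' (clin_fpre _ (cPhi s01)) (clin_fpre _ (cPsi s01))
    (c := fun=> B * w s t `^ (i%:R / p)) (d := fun=> M * w s t `^ (j%:R / p))) => //.
  - by move=> _; rewrite mulr_ge0 ?powR_ge0.
  - by move=> _; rewrite mulr_ge0 ?powR_ge0.
  - by rewrite !mulr_ge0.
  - move=> l _; apply: (@lbound_le _ _ _ _ (B * `|b i|)).
      by apply: lbound_fpre => //; exact: Phi_bound.
    by rewrite ler_wpM2l//; exact: dw.2.
  - move=> l _; apply: (@lbound_le _ _ _ _ (M * `|b j|)).
      by apply: lbound_fpre => //; exact: Psi_bound.
    by rewrite ler_wpM2l//; exact: dw.2.
  move=> _ _; rewrite mulrACA ler_wpM2l ?mulr_ge0//.
  (* The lost terms satisfy i + j + k >= N + 1, hence (i + j)/p >= (N + 1)/p - k/p >= theta - k/p.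
     This is where the cap on theta enters. *)
  have ijk' : N.+1%:R / p <= i%:R / p + j%:R / p + k%:R / p.
    rewrite -!mulrDl -!natrD ler_wpM2r ?invr_ge0 ?(le_trans ler01 p1)// ler_nat.
    by move: ijk; clear; move: (Num.truncn p) => n; lia.
  have kp := le1 _ kN'.
  rewrite -powRD; last by apply/implyP => /eqP; lra.
  by apply: slack; have := le1 _ iN; have := le1 _ jN; lra.
move=> y; rewrite iterated_defectE//; last 2 first.
- by move=> r; rewrite !inE => /orP[]/eqP ->; exact: Hbeta1.
- by move=> r; rewrite !inE => /orP[]/eqP ->; exact: Hbeta2.
have h4 : `|\sum_(i < N.+1) \sum_(j < N.+1) if (N - k < i + j)%N then
    shprod W true (fpre (b i) (Phi s)) (fpre (b j) (Psi s)) k y else 0|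
    <= N.+1%:R ^+ 2 * (P * (B * M * (H ^+ 3 * q))) * `|y|.
  set Q := P * _; have Q0 : 0 <= Q by rewrite !mulr_ge0.
  have -> : N.+1%:R ^+ 2 * Q * `|y| = \sum_(i < N.+1) \sum_(j < N.+1) Q * `|y|.
    by rewrite !sumr_const card_ord -mulrnA -[in RHS]mulr_natl natrM; ring.
  apply: le_trans (ler_norm_sum _ _ _) _; apply: ler_sum => i _.
  apply: le_trans (ler_norm_sum _ _ _) _; apply: ler_sum => j _.
  have := h3 i j (leq_ord i) (leq_ord j).
  case: ifP => [_ /(_ isT)/(_ y)|_ _]; last first.
    by rewrite normr0 mulr_ge0.
  by [].
apply: le_trans (ler_normD _ _) _; apply: le_trans (lerD (ler_normD _ _) h4) _.
apply: le_trans (lerD (lerD (h1 y) (h2 y)) (lexx _)) _.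
by rewrite le_eqVlt; apply/orP; left; apply/eqP; ring.
Qed.

End IteratedBound.

Lemma control_add {R : realType} (w1 w2 : R -> R -> R) :
  control w1 -> control w2 -> control (fun s t => w1 s t + w2 s t).
Proof.
move=> [g1 h1 s1 c1] [g2 h2 s2 c2]; split.
- by move=> s t s0 st t1; rewrite addr_ge0 ?g1 ?g2.
- by move=> t t0 t1; rewrite h1// h2// addr0.
- by move=> s u t s0 su ut t1; rewrite addrACA lerD ?s1 ?s2.
by move=> z; apply: cvgD; [exact: c1|exact: c2].
Qed.

Lemma superadditive_add {R : realType} (w1 w2 : R -> R -> R) :
  superadditive w1 -> superadditive w2 -> superadditive (fun s t => w1 s t + w2 s t).
Proof.
move=> [g1 h1 s1] [g2 h2 s2]; split.
- by move=> s t s0 st t1; rewrite addr_ge0 ?g1 ?g2.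
- by move=> t t0 t1; rewrite h1// h2// addr0.
by move=> s u t s0 su ut t1; rewrite addrACA lerD ?s1 ?s2.
Qed.

(** * Existence of the rough integral *)

Section RoughIntegral.
Context {R : realType} {V : completeNormedModType R} {T : tensor_powers V}.
Context {U : completeNormedModType R} (p : R) (X : R -> tseries T).
Hypothesis p1 : (1 <= p :> R).
Hypothesis HX : geometric_rough_path p X.
Let N := Num.truncn p.
Context (beta : R -> eform T U).
Hypothesis Hbeta : one_form p beta.

Lemma drives_ge (w : R -> R -> R) : superadditive w ->
  (forall s t : R, 0 <= s -> s < t -> t <= 1 -> fine (pvar p X s t) <= w s t) ->
  drives p X w.
Proof.
move=> sw hw; split=> // s t k s0 st t1.
apply: le_trans (norm_pincr p1 HX k s0 st t1) _.
apply: powR_mono; [exact: div_p_ge0| |exact: hw].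
by rewrite fine_ge0// pvar_ge0// ltW.
Qed.

Let Xi s t : U := form_eval N (beta s) (pincr X s t).

(** The limit is constructed with [w1 + wX], where [wX] is a control dominating the p-variation:
    this sum is continuous, as [sewing_exists] requires. *)
Lemma rough_integralP (w1 : R -> R -> R) (M theta1 t : R) : control w1 -> 0 <= M ->
  1 < theta1 ->
  (forall (s t : R) k, 0 <= s -> s < t -> t <= 1 -> (1 <= k <= N)%N ->
    lbound (@defect R V T U N X beta s t k) (M * w1 s t `^ (theta1 - k%:R / p))) ->
  0 <= t -> t <= 1 -> is_sewing Xi t (rough_integral p X beta t).
Proof.
move=> cw1 M0 th bD t0 t1; have [_ [wX cwX hX]] := HX.
pose w s t := w1 s t + wX s t.
have cw : control w by exact: control_add.
have sw := control_superadditive cw.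
have dw : drives p X w.
  apply: drives_ge => // s r s0 sr r1.
  have fin := pvar_fin_num HX s0 (ltW sr) r1.
  apply: (@le_trans _ _ (wX s r)).
    by rewrite -lee_fin fineK//; exact: hX (ltW sr) r1.
  by rewrite lerDr (control_ge0 cw1)// ltW.
have [J JP] : exists J, is_sewing Xi t J.
  apply: (@sewing_exists _ _ w theta1 (N%:R * M)) => //.
  - by rewrite mulr_ge0.
  - exact: form_eval_pincr_diag.
  apply: (form_eval_almost_additive p1 HX Hbeta dw M0 th) => s r k s0 sr r1 kN.
  apply: lbound_le (bD s r k s0 sr r1 kN) _; rewrite ler_wpM2l// powR_mono//.
  - by have := truncn_div_le1 p1 (andP kN).2; lra.
  - by rewrite (control_ge0 cw1)// ltW.
  - by rewrite lerDl (control_ge0 cwX)// ltW.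
by rewrite /rough_integral; apply: getPex; exists J.
Qed.

End RoughIntegral.

(** * The constant of the estimate *)

Section Constant.
Context {R : realType}.
Implicit Types p theta h : R.

(** The n degrees of a defect each contribute to the additivity error, and sewing multiplies the
    total by [sewing_const]. *)
Definition increment_const (n : nat) theta h : R :=
  sewing_const theta * (n%:R * defect_const n h).

(** |I_t| is at most |Xi 0 t| plus the sewing error over [0, t]. The summand 1 makes the constant
    dominate the sup norm of beta1 as well, so that all components of the extended form share one
    bound. *)
Definition integral_const (n : nat) theta h : R :=
  1 + n%:R * h + increment_const n theta h * h `^ theta.

(** The two summands are the constants of [indef_bound] and [indef_defect_bound], with the norms of
    beta1 and beta2 factored out. *)
Definition iterated_const p theta (w01 : R) : R :=
  let n := Num.truncn p in let h := 1 + w01 in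
  let e := defect_const n h + increment_const n theta h in
  let b := integral_const n theta h in
  n.+1%:R * (n`!)%:R * b +
  n.+1%:R * (n`!)%:R * h ^+ 3 * (e + n.+1%:R * h * b * defect_const n h + n.+1%:R ^+ 2 * b).

End Constant.

Theorem proposition30 (R : realType) :
  exists C : R -> R -> R -> R,
  forall (p : R) (V : completeNormedModType R) (T : tensor_powers V)
    (U1 U2 : completeNormedModType R) (W : tensor_product U1 U2)
    (X : R -> tseries T) (beta1 : R -> eform T U1) (beta2 : R -> eform T U2)
    (w1 w2 : R -> R -> R) (theta1 theta2 : R),
  1 <= p ->
  tensor_maps_bounded T W ->
  geometric_rough_path p X ->
  one_form p beta1 -> one_form p beta2 ->
  control w1 -> control w2 ->
  1 < theta1 -> 1 < theta2 ->
  (slow_norm p X beta1 w1 theta1 < +oo)%E ->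
  (slow_norm p X beta2 w2 theta2 < +oo)%E ->
  let w := fun s t => w1 s t + w2 s t + fine (pvar p X s t) in
  let theta := Num.min (Num.min theta1 theta2) ((Num.truncn p).+1%:R / p) in
  (slow_norm p X (iterated_form W p X beta1 beta2) w theta
     <= (C p theta (w 0 1))%:E
        * slow_norm p X beta1 w1 theta1 * slow_norm p X beta2 w2 theta2)%E.
Proof.
exists iterated_const => p V T U1 U2 W X beta1 beta2 w1 w2 theta1 theta2 p1 hW HX
  Hb1 Hb2 cw1 cw2 th1 th2 fin1 fin2.
pose w s t := w1 s t + w2 s t + fine (pvar p X s t).
pose theta := Num.min (Num.min theta1 theta2) ((Num.truncn p).+1%:R / p).
suff : (slow_norm p X (iterated_form W p X beta1 beta2) w theta
     <= (iterated_const p theta (w 0 1))%:E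
        * slow_norm p X beta1 w1 theta1 * slow_norm p X beta2 w2 theta2)%E by [].
set N := Num.truncn p in theta *; set H := 1 + w 0 1.
have p0 : 0 < p by exact: lt_le_trans ltr01 p1.
have th : 1 < theta.
  by rewrite /theta !lt_min th1 th2 ltr_pdivlMr// mul1r truncnS_gt.
have [tht1 tht2 thtN] : [/\ theta <= theta1, theta <= theta2 & theta <= N.+1%:R / p].
  by rewrite /theta !ge_min !lexx ?orbT.
clearbody theta.
have in01 (s t : R) : 0 <= s -> s < t -> t <= 1 -> 0 <= s <= 1 /\ 0 <= t <= 1.
  by move=> s0 st t1; lra.
have sp := superadditive_pvar HX.
have pv0 (s t : R) : 0 <= s -> s < t -> t <= 1 -> 0 <= fine (pvar p X s t).
  by move=> s0 st t1; apply: (superadd_ge0 sp) => //; exact: ltW.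
have w1_0 (s t : R) : 0 <= s -> s < t -> t <= 1 -> 0 <= w1 s t.
  by move=> s0 st t1; apply: (control_ge0 cw1) => //; exact: ltW.
have w2_0 (s t : R) : 0 <= s -> s < t -> t <= 1 -> 0 <= w2 s t.
  by move=> s0 st t1; apply: (control_ge0 cw2) => //; exact: ltW.
have sw : superadditive w.
  apply: superadditive_add => //.
  by apply: superadditive_add; exact: control_superadditive.
have dw : drives p X w.
  by apply: drives_ge => // s t s0 st t1; rewrite lerDr addr_ge0 ?w1_0 ?w2_0.
have [|M1 [-> M10 bM1 bD1]] := slow_norm_bounds Hb1 fin1.
  by move=> s t s0 st t1 k kN; have [s01 t01] := in01 s t s0 st t1;
    case: (clinear_defect X Hb1 s01 t01 kN).
have [|M2 [-> M20 bM2 bD2]] := slow_norm_bounds Hb2 fin2.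
  by move=> s t s0 st t1 k kN; have [s01 t01] := in01 s t s0 st t1;
    case: (clinear_defect X Hb2 s01 t01 kN).
have H1 : 1 <= H by exact: (drives_H_ge1 dw).
have H0 : 0 <= H by exact: le_trans ler01 H1.
set dc := defect_const N H; have dc1 : 1 <= dc by exact: defect_const_ge1.
have dc0 : 0 <= dc by exact: le_trans ler01 dc1.
have d1 : forall (s t : R) k, 0 <= s -> s < t -> t <= 1 -> (1 <= k <= N)%N ->
    lbound (@defect R V T U1 N X beta1 s t k) (dc * M1 * w s t `^ (theta - k%:R / p)).
  have w1w (s t : R) : 0 <= s -> s < t -> t <= 1 -> 0 <= w1 s t <= w s t.
    by move=> s0 st t1; rewrite w1_0// /w -addrA lerDl addr_ge0 ?w2_0 ?pv0.
  exact (defect_bound p1 dw M10 th tht1 w1w bM1 bD1).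
have d2 : forall (s t : R) k, 0 <= s -> s < t -> t <= 1 -> (1 <= k <= N)%N ->
    lbound (@defect R V T U2 N X beta2 s t k) (dc * M2 * w s t `^ (theta - k%:R / p)).
  have w2w (s t : R) : 0 <= s -> s < t -> t <= 1 -> 0 <= w2 s t <= w s t.
    by move=> s0 st t1; rewrite w2_0// /w [w1 s t + _]addrC -addrA lerDl addr_ge0 ?w1_0 ?pv0.
  exact (defect_bound p1 dw M20 th tht2 w2w bM2 bD2).
pose I := rough_integral p X beta1.
pose Xi s t := form_eval N (beta1 s) (pincr X s t).
(* Existence uses the given [w1] and [theta1]; the increments are then estimated with [w] and
   [theta]. *)
have sI (t : R) : 0 <= t -> t <= 1 -> is_sewing Xi t (I t).
  exact: (rough_integralP p1 HX Hb1 cw1 M10 th1 bD1).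
set K := increment_const N theta H.
have K0 : 0 <= K by rewrite /K /increment_const mulr_ge0 ?sewing_const_ge0// mulr_ge0.
have Xi0 : forall t : R, 0 <= t -> t <= 1 -> Xi t t = 0 by exact: form_eval_pincr_diag.
have dI' : forall s t : R, 0 <= s -> s <= t -> t <= 1 ->
    `|I t - I s - Xi s t| <= K * M1 * w s t `^ theta.
  move=> s t s0 st t1; have dcM : 0 <= dc * M1 by rewrite mulr_ge0.
  have aa := form_eval_almost_additive p1 HX Hb1 dw dcM th d1.
  have Nd : 0 <= N%:R * (dc * M1) by rewrite mulr_ge0.
  have h := sewing_increment sw th Nd Xi0 aa s0 st t1 (sI s s0 (le_trans st t1))
    (sI t (le_trans s0 st) t1).
  by apply: le_trans h _; rewrite /K /increment_const -/dc !mulrA.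
(* The empty list is a partition of [0, 0], of sum 0 and of any mesh. *)
have I0 : I 0 = 0.
  apply/eqP; rewrite -normr_le0; apply/ler_addgt0Pr => e e0; rewrite add0r.
  have [d d0 /(_ [::])] := sI 0 (lexx 0) ler01 e e0.
  rewrite partition_sum_nil sub0r normrN => hI; by apply: ltW; apply: hI.
set Bc := integral_const N theta H.
have NH0 : 0 <= N%:R * H by rewrite mulr_ge0.
have KH0 : 0 <= K * H `^ theta by rewrite mulr_ge0 ?powR_ge0.
have Bc1 : 1 <= Bc by rewrite /Bc /integral_const -addrA lerDl addr_ge0.
have bI : forall t : R, 0 <= t -> t <= 1 -> `|I t| <= Bc * M1.
  move=> t t0 t1; have := dI' 0 t (lexx 0) t0 t1; rewrite I0 subr0 => h.
  have g := form_eval_bound p1 HX Hb1 dw M10 (lexx 0) t0 t1 bM1.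
  have wH : w 0 t `^ theta <= H `^ theta.
    apply: powR_mono; [exact: ltW (lt_trans ltr01 th)|exact: (superadd_ge0 sw)|].
    exact: (drives_le_H dw).
  rewrite -[I t](subrK (Xi 0 t)) (le_trans (ler_normD _ _))//.
  apply: le_trans (lerD h g) _; rewrite /Bc /integral_const -/K -/H.
  have KM : 0 <= K * M1 by rewrite mulr_ge0.
  have := ler_wpM2l KM wH; rewrite -/N -/H; set q := H `^ theta; set r := w 0 t `^ _.
  by move: M10; move: (N%:R) => n M10'; lra.
have Bc0 : 0 <= Bc by exact: le_trans ler01 Bc1.
have B0 : 0 <= Bc * M1 by rewrite mulr_ge0.
have bB (t : R) k : 0 <= t -> t <= 1 -> (1 <= k <= N)%N -> lbound (@beta1 t k) (Bc * M1).
  by move=> t0 t1 kN; apply: lbound_le (bM1 t k t0 t1 kN) _; rewrite ler_peMl.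
(* One constant for all degrees of the defect of the extended beta1: [K] for the sewing error in
   degree 0, [dc] for the others. *)
set e := dc + K; have e0 : 0 <= e by rewrite addr_ge0.
have E0 : 0 <= e * M1 by rewrite mulr_ge0.
have F0 : 0 <= dc * M2 by rewrite mulr_ge0.
have dI : forall s t : R, 0 <= s -> s < t -> t <= 1 ->
    `|I t - I s - Xi s t| <= e * M1 * w s t `^ theta.
  move=> s t s0 st t1; apply: le_trans (dI' s t s0 (ltW st) t1) _.
  by rewrite ler_wpM2r ?powR_ge0// ler_wpM2r// lerDr.
have d1' : forall (s t : R) k, 0 <= s -> s < t -> t <= 1 -> (1 <= k <= N)%N ->
    lbound (@defect R V T U1 N X beta1 s t k) (e * M1 * w s t `^ (theta - k%:R / p)).
  move=> s t k s0 st t1 kN; apply: lbound_le (d1 s t k s0 st t1 kN) _.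
  by rewrite ler_wpM2r ?powR_ge0// ler_wpM2r// lerDl.
have bound := indef_bound hW Hb1 Hb2 B0 M20 bI bB bM2.
have dbound := indef_defect_bound hW p1 HX Hb1 Hb2 dw th thtN B0 M20 E0 F0 bI bB bM2
  dI d1' d2.
apply: le_trans (slow_norm_le _ _ bound dbound) _.
- by rewrite !mulr_ge0.
- by repeat first [done | apply: addr_ge0 | apply: mulr_ge0 | apply: exprn_ge0].
rewrite -!EFinM lee_fin /iterated_const -/N -/H -/dc -/K -/e -/Bc.
by rewrite le_eqVlt; apply/orP; left; apply/eqP; ring.
Qed.
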